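(* Let $\{X_t\}$ be an irreducible Markov chain on a finite state space $\Sigma$ and let $i\in\Sigma$, $\epsilon,\alpha\in(0,1)$. Run $\mathrm{IteratedRefinement}(i,\epsilon,\alpha)$. Then with probability greater than $1-\alpha$, for all iterations $k$, $$\left(1-\epsilon-4\cdot 2^{-2^k/(2H_i)}Z_{\max}(i)\right)\hat\pi_i^{(k)}\le\left(1-\epsilon-2Z_{\max}(i)\,\mathbb P_i\big(T_i>\theta^{(k)}\big)\right)\hat\pi_i^{(k)}\le\pi_i\le(1+\epsilon)\hat\pi_i^{(k)},$$ and the number of random walk steps taken by the algorithm within the first $k$ iterations is bounded by $$\tilde O\left(\frac{\ln(1/\alpha)\,2^k}{\epsilon^2}\right).$$
   Context: Chain: $\{X_t\}_{t\ge0}$ is a discrete-time Markov chain with transition matrix $P$ and unique stationary distribution $\pi$; $\mathbb P_i(\cdot)=\mathbb P(\cdot\mid X_0=i)$, $\mathbb E_i[\cdot]=\mathbb E[\cdot\mid X_0=i]$; $T_i=\inf\{t\ge1:X_t=i\}$. Mixing quantities (finite $\Sigma$): $H_i=\max_{j\in\Sigma}\mathbb E_j[T_i]$; the fundamental matrix is $Z=(I-P+\mathbf 1\pi^T)^{-1}$, also written $Z=\sum_{t\ge0}(P^t-\mathbf 1\pi^T)$; $Z_{\max}(i)=\max_{k\in\Sigma}|Z_{ki}|$. Algorithm $\mathrm{IteratedRefinement}(i,\epsilon,\alpha)$: iterations $k=1,2,\dots$ with truncation thresholds $\theta^{(k)}=2^k$ and sample sizes $N^{(1)}=\lceil 6(1+\epsilon)\ln(8/\alpha)/\epsilon^2\rceil$,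 $N^{(k+1)}=\lceil 3(1+\epsilon)\theta^{(k+1)}\ln(4\theta^{(k+1)}/\alpha)/(\hat T_i^{(k)}\epsilon^2)\rceil$. In iteration $k$, $N^{(k)}$ fresh independent realizations of the chain started at $X_0=i$ are simulated, each stopped at the first time $t\ge1$ with $t=\theta^{(k)}$ or $X_t=i$; the $s$-th has length $t_s$ distributed as $\min(T_i,\theta^{(k)})$. Set $\hat T_i^{(k)}=\frac1{N^{(k)}}\sum_{s=1}^{N^{(k)}}t_s$ and $\hat\pi_i^{(k)}=1/\hat T_i^{(k)}$. The number of random walk steps in iteration $k$ is $N^{(k)}\hat T_i^{(k)}$. Notation: $\tilde O(f(a)g(b))=O(f(a)\,\mathrm{polylog} f(a))\,O(g(b)\,\mathrm{polylog} g(b))$. *)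

(* Defs.v *)
From HB Require Import structures.
From mathcomp Require Import all_boot all_order all_algebra.
From mathcomp Require Import all_classical all_reals all_analysis.

Set Implicit Arguments.
Unset Strict Implicit.
Unset Printing Implicit Defensive.

Import Order.TTheory GRing.Theory Num.Theory.
Import numFieldNormedType.Exports.

Local Open Scope classical_set_scope.
Local Open Scope ring_scope.

Section TransitionMatrix.
Context (R : realType) (Sigma : finType).
Implicit Types (P : Sigma -> Sigma -> R) (pi : Sigma -> R).

Definition stochastic P : Prop :=
  (forall x y, 0 <= P x y) /\ (forall x, \sum_y P x y = 1).

Definition stationary P pi : Prop :=
  [/\ forall x, 0 <= pi x, \sum_x pi x = 1 &
      forall y, \sum_x pi x * P x y = pi y].

Definition transition_mx P : 'M[R]_#|Sigma| :=
  \matrix_(a, b) P (enum_val a) (enum_val b).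

Definition irreducible P : Prop :=
  forall x y, exists t : nat,
    0 < (transition_mx P ^+ t) (enum_rank x) (enum_rank y).

(* Defined by the inverse and not by the series of the P^t - 1 pi^T, which
   diverges when the chain is periodic. *)
Definition fundamental_mx P pi : 'M[R]_#|Sigma| :=
  invmx (1%:M - transition_mx P
         + (const_mx 1 : 'cV[R]_#|Sigma|) *m (\row_b pi (enum_val b))).

Definition Zmax P pi (i : Sigma) : R :=
  \big[Num.max/0]_(k : Sigma)
    `|fundamental_mx P pi (enum_rank k) (enum_rank i)|.

End TransitionMatrix.

Section MarkovChain.
Context (R : realType) (Sigma : finType) (d : measure_display)
  (Omega : measurableType d).
Implicit Types (X : nat -> Omega -> Sigma) (Pr : probability Omega R).

(* The Markov property is written with the conditioning event multiplied out,
   so that histories of probability 0 need no special treatment. *)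
Definition markov_chain Pr X (P : Sigma -> Sigma -> R) (i : Sigma) : Prop :=
  [/\ forall t x, measurable [set w | X t w = x],
      Pr [set w | X 0%N w = i] = 1%E &
      forall (t : nat) (x : nat -> Sigma),
        Pr [set w | forall s, (s <= t.+1)%N -> X s w = x s] =
        (Pr [set w | forall s, (s <= t)%N -> X s w = x s]
         * (P (x t) (x t.+1))%:E)%E].

Definition process_sigma_algebra X : set_system Omega :=
  <<s [set A | exists t x, A = [set w | X t w = x]] >>.

Definition independent_processes (I : eqType) Pr
    (W : I -> nat -> Omega -> Sigma) : Prop :=
  forall (s : seq I) (A : I -> set Omega), uniq s ->
    (forall j, j \in s -> process_sigma_algebra (W j) (A j)) ->
    Pr (\bigcap_(j in [set` s]) A j) = (\prod_(j <- s) Pr (A j))%E.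

End MarkovChain.

Section HittingTimes.
Context (R : realType) (Sigma : finType).
Implicit Types (x : nat -> Sigma) (i : Sigma).

(* Return time to i along the trajectory x; +oo if x never returns. *)
Definition hitting_time i x : \bar R :=
  ereal_inf [set t%:R%:E | t in [set t : nat | (1 <= t)%N /\ x t = i]].

(* First t >= 1 with t = theta or x t = i; meaningful for theta >= 1. *)
Definition stop_time (theta : nat) i x : nat :=
  (find (fun t => (t == theta) || (x t == i)) (iota 1 theta)).+1.

Context (d : measure_display) (Omega : measurableType d).

(* (PP j) is the law of the chain X conditioned on X_0 = j. *)
Definition mean_hitting_time (PP : Sigma -> probability Omega R)
    (X : nat -> Omega -> Sigma) (j i : Sigma) : \bar R :=
  (\int[PP j]_w hitting_time i (X ^~ w))%E.

Definition max_hitting_time (PP : Sigma -> probability Omega R)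
    (X : nat -> Omega -> Sigma) (i : Sigma) : \bar R :=
  \big[Order.max/-oo%E]_(j : Sigma) mean_hitting_time PP X j i.

End HittingTimes.

(* x k s is the s-th trajectory (s = 0, 1, ...) available to iteration k;
   iteration k uses the first (sample_size k) of them.  Iterations are numbered
   from 1: index 0 carries no meaning. *)
Section IteratedRefinement.
Context (R : realType) (Sigma : finType) (i : Sigma) (eps alpha : R)
  (x : nat -> nat -> nat -> Sigma).

Definition threshold (k : nat) : nat := (2 ^ k)%N.

Definition average_time (k N : nat) : R :=
  N%:R^-1 * \sum_(s < N) (stop_time (threshold k) i (x k s))%:R.

Definition nat_ceil (r : R) : nat := `|Num.ceil r|%N.

Fixpoint sample_size (k : nat) : nat :=
  if k is l.+1 then
    if l == 0%N then
      nat_ceil (6 * (1 + eps) * ln (8 / alpha) / eps ^+ 2)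
    else
      nat_ceil (3 * (1 + eps) * (threshold k)%:R
                * ln (4 * (threshold k)%:R / alpha)
                / (average_time l (sample_size l) * eps ^+ 2))
  else 0%N.

Definition That (k : nat) : R := average_time k (sample_size k).

Definition pihat (k : nat) : R := (That k)^-1.

Definition total_steps (k : nat) : R :=
  \sum_(1 <= l < k.+1) (sample_size l)%:R * That l.

End IteratedRefinement.

(* The generic member C x (1 + ln x)^c of O(x polylog x).  As usual for O, it is
   a statement about arguments bounded away from 0, so x is read as max(1, x):
   this is needed for x = ln (1 / alpha), which tends to 0 as alpha tends
   to 1. *)
Definition softO (R : realType) (C : R) (c : nat) (x : R) : R :=
  C * (Num.max 1 x * (1 + ln (Num.max 1 x)) ^+ c).

(* Main.v *)
(* With [u t j] the probability that the chain started at [j] avoids [i] at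
   times 1, ..., t, the truncated return time [min T theta] has mean
   [m = sum_(t < theta) u t i].  Stationarity gives
   [1 - pi_i m = sum_x pi_x u theta x >= 0], and the Poisson equation solved by
   the i-th column of the fundamental matrix gives
   [1 - pi_i m <= 2 Zmax (u theta i)]; so [pi_i m] is 1 up to the stated bias.
   Chernoff bounds compare the empirical mean with [m]: iteration [k] fails with
   probability at most [alpha / 2^(k+1)] whenever its sample size is large
   enough, and success of iteration [k] makes the next sample size large enough.
   The sample size of an iteration is a function of the earlier walks only, so
   the Chernoff argument applies conditionally on it.  On success the estimates
   of two consecutive levels differ by at most a constant factor, whence the
   bound on the number of steps. *)
Require Import Defs.
From HB Require Import structures.
From mathcomp Require Import all_boot all_order all_algebra.
From mathcomp Require Import all_classical all_reals all_analysis.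
From mathcomp Require Import measurable_realfun ring lra.

Set Implicit Arguments.
Unset Strict Implicit.
Unset Printing Implicit Defensive.

Import Order.TTheory GRing.Theory Num.Theory.
Import numFieldNormedType.Exports.

Local Open Scope classical_set_scope.
Local Open Scope ring_scope.

(** * Probabilities of avoiding [i] and truncated mean return times *)

Section Taboo.
Context (R : realType) (Sigma : finType) (P : Sigma -> Sigma -> R) (i : Sigma).
Hypothesis sP : stochastic P.

(** The transition operator with the column of [i] deleted: one step of the chain killed on entering
    [i]. *)
Definition taboo (f : Sigma -> R) (x : Sigma) : R :=
  \sum_(y | y != i) P x y * f y.

Definition survival (t : nat) : Sigma -> R := iter t taboo (fun=> 1).

(** Tail-sum formula for the mean of [min T n], with [T] the first time at least 1 spent in [i]. *)
Definition truncated_mean (n : nat) (x : Sigma) : R :=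
  \sum_(t < n) survival t x.

Lemma taboo_le (f g : Sigma -> R) :
  (forall x, f x <= g x) -> forall x, taboo f x <= taboo g x.
Proof. by move=> fg x; apply: ler_sum => y _; rewrite ler_wpM2l ?sP.1. Qed.

Lemma taboo_scale (a : R) (f : Sigma -> R) (x : Sigma) :
  taboo (fun y => a * f y) x = a * taboo f x.
Proof. by rewrite /taboo mulr_sumr; apply: eq_bigr => y _; rewrite mulrCA. Qed.

Lemma iter_taboo_le (f g : Sigma -> R) (n : nat) :
  (forall x, f x <= g x) -> forall x, iter n taboo f x <= iter n taboo g x.
Proof. by elim: n => //= n IHn fg x; apply: taboo_le => y; apply: IHn. Qed.

Lemma iter_taboo_scale (a : R) (f : Sigma -> R) (n : nat) :
  iter n taboo (fun y => a * f y) = fun x => a * iter n taboo f x.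
Proof.
by elim: n => //= n ->; apply/funext => x; rewrite -taboo_scale.
Qed.

Lemma survivalS (n : nat) : survival n.+1 = taboo (survival n).
Proof. by []. Qed.

Lemma survival_ge0 (n : nat) (x : Sigma) : 0 <= survival n x.
Proof.
elim: n x => [x|n IHn x]; first exact: ler01.
by rewrite survivalS; apply: sumr_ge0 => y _; rewrite mulr_ge0 ?sP.1.
Qed.

Lemma survival_le_iter (a : R) (f : Sigma -> R) (n : nat) :
  (forall x, f x <= a) -> forall x, iter n taboo f x <= a * survival n x.
Proof.
move=> fa x; rewrite -[leRHS]/((fun x => a * survival n x) x) -iter_taboo_scale.
by apply: iter_taboo_le => y; rewrite mulr1.
Qed.

Lemma survival1_le1 (x : Sigma) : survival 1 x <= 1.
Proof.
rewrite /survival /= /taboo -[leRHS](sP.2 x) [leRHS](bigID (fun y => y != i)) /=.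
rewrite (eq_bigr (P x)) ?lerDl; last by move=> y _; rewrite mulr1.
by apply: sumr_ge0 => y _; rewrite sP.1.
Qed.

Lemma survival_anti (m n : nat) (x : Sigma) :
  (m <= n)%N -> survival n x <= survival m x.
Proof.
move=> /subnKC <-; elim: (n - m)%N => [|k IHk]; first by rewrite addn0.
apply: le_trans IHk; rewrite addnS /survival iterSr.
by apply: iter_taboo_le => y; exact: survival1_le1.
Qed.

Lemma survival_le1 (n : nat) (x : Sigma) : survival n x <= 1.
Proof. exact: (@survival_anti 0 n). Qed.

(** Markov property at time [m]: the innermost [n] killed steps are bounded by the constant [a].
    Iterated, this gives geometric decay. *)
Lemma survival_submul (a : R) (m n : nat) (x : Sigma) :
  (forall y, survival n y <= a) -> survival (m + n) x <= a * survival m x.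
Proof. by move=> na; rewrite /survival iterD; exact: survival_le_iter. Qed.

Lemma survival_geometric (a : R) (n q : nat) (x : Sigma) :
  0 <= a -> (forall y, survival n y <= a) -> survival (q * n) x <= a ^+ q.
Proof.
move=> a0 na; elim: q => [|q IHq]; first by rewrite mul0n expr0 survival_le1.
rewrite mulSn addnC exprS (le_trans (survival_submul _ _ na)) //.
exact: ler_wpM2l.
Qed.

Lemma truncated_meanS (n : nat) (x : Sigma) :
  truncated_mean n.+1 x = truncated_mean n x + survival n x.
Proof. by rewrite /truncated_mean big_ord_recr. Qed.

Lemma truncated_mean_ge1 (n : nat) (x : Sigma) :
  (0 < n)%N -> 1 <= truncated_mean n x.
Proof.
case: n => // n _; rewrite /truncated_mean big_ord_recl lerDl.
by apply: sumr_ge0 => t _; exact: survival_ge0.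
Qed.

Lemma truncated_mean_mono (m n : nat) (x : Sigma) :
  (m <= n)%N -> truncated_mean m x <= truncated_mean n x.
Proof.
move=> /subnKC <-; rewrite /truncated_mean big_split_ord /= lerDl.
by apply: sumr_ge0 => t _; exact: survival_ge0.
Qed.

(** Survival decreases in time, so the second half of the sum is termwise below the first. This
    keeps consecutive levels comparable in the step count. *)
Lemma truncated_mean_double (n : nat) (x : Sigma) :
  truncated_mean (n + n) x <= 2 * truncated_mean n x.
Proof.
rewrite /truncated_mean big_split_ord /= mulr_natl mulr2n lerD2l.
by apply: ler_sum => t _; apply: survival_anti; rewrite leq_addl.
Qed.

Lemma taboo_truncated_mean (n : nat) (x : Sigma) :
  taboo (truncated_mean n) x = truncated_mean n.+1 x - 1.
Proof.
rewrite /truncated_mean big_ord_recl addrAC subrr add0r /taboo.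
under eq_bigr => y _ do rewrite mulr_sumr.
by rewrite exchange_big.
Qed.

Section Stationary.
Context (pi : Sigma -> R).
Hypothesis spi : stationary P pi.

(** By stationarity, a killed step under [pi] drops exactly the term of [i] from the sum; the losses
    [pi i * survival n i] add up to the truncated mean. *)
Lemma stationary_survival (n : nat) :
  \sum_x pi x * survival n x = 1 - pi i * truncated_mean n i.
Proof.
case: spi => pi0 pi1 piP; elim: n => [|n IHn].
  rewrite /truncated_mean big_ord0 mulr0 subr0 -[RHS]pi1.
  by apply: eq_bigr => x _; rewrite mulr1.
rewrite truncated_meanS mulrDr opprD addrA -IHn survivalS /taboo.
under eq_bigr do rewrite mulr_sumr.
rewrite exchange_big [X in _ = X - _](bigD1 i) //= addrAC subrr add0r.
apply: eq_bigr => y _; rewrite -[in RHS]piP mulr_suml.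
by apply: eq_bigr => x _; rewrite mulrA.
Qed.

Lemma stationary_truncated_mean_le1 (n : nat) :
  pi i * truncated_mean n i <= 1.
Proof.
rewrite -subr_ge0 -stationary_survival; apply: sumr_ge0 => x _.
by rewrite mulr_ge0 ?survival_ge0 //; case: spi.
Qed.

End Stationary.
End Taboo.

(** * The fundamental matrix and the truncation bias *)

Section FundamentalMatrix.
Context (R : realType) (Sigma : finType) (P : Sigma -> Sigma -> R)
  (pi : Sigma -> R).
Hypotheses (sP : stochastic P) (iP : irreducible P) (spi : stationary P pi).

Let T := transition_mx P.
Let one : 'cV[R]_#|Sigma| := const_mx 1.
Let pirow : 'rV[R]_#|Sigma| := \row_b pi (enum_val b).

Lemma sum_enum_val (F : Sigma -> R) :
  \sum_(a < #|Sigma|) F (enum_val a) = \sum_x F x.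
Proof. by rewrite -big_enum_val; apply: eq_bigl => x; rewrite inE. Qed.


Lemma transition_one : T *m one = one.
Proof.
apply/colP => a; rewrite !mxE.
under eq_bigr do rewrite !mxE mulr1.
by rewrite (sum_enum_val (P (enum_val a))) sP.2.
Qed.

Lemma stationary_transition : pirow *m T = pirow.
Proof.
case: spi => _ _ piP; apply/rowP => b; rewrite !mxE.
under eq_bigr do rewrite !mxE.
by rewrite (sum_enum_val (fun x => pi x * P x (enum_val b))) piP.
Qed.

Lemma stationary_one : pirow *m one = 1%:M.
Proof.
case: spi => _ pi1 _; apply/rowP => b; rewrite !mxE ord1 eqxx.
under eq_bigr do rewrite !mxE mulr1.
by rewrite sum_enum_val pi1.
Qed.

Lemma transition_pow_one (t : nat) : (T ^+ t) *m one = one.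
Proof.
elim: t => [|t IHt]; first by rewrite expr0 mul1mx.
by rewrite exprSr -mulmxA transition_one.
Qed.

Lemma transition_pow_ge0 (t : nat) a b : 0 <= (T ^+ t) a b.
Proof.
elim: t a b => [|t IHt] a b; first by rewrite expr0 mxE; case: eqP.
rewrite exprS mxE; apply: sumr_ge0 => c _.
by rewrite mulr_ge0 // mxE sP.1.
Qed.

(* Maximum principle: at a maximum of f, f a is an average of the values f b
   with all weights (T ^+ t) a b. *)
Lemma harmonic_constant (f : 'cV[R]_#|Sigma|) :
  T *m f = f -> forall a b, f a 0 = f b 0.
Proof.
move=> Tf.
have Ttf t : T ^+ t *m f = f.
  by elim: t => [|t IHt]; rewrite ?expr0 ?mul1mx // exprSr -mulmxA Tf.
suff maxP a : (forall b, f b 0 <= f a 0) -> forall b, f b 0 = f a 0.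
  move=> a b; have [m fm] : exists m, forall b, f b 0 <= f m 0.
    exists [arg max_(m > a) f m 0]%O => c.
    by case: arg_maxP => // m _ /(_ c isT).
  by rewrite (maxP _ fm) [RHS](maxP _ fm).
move=> fa b; have [t] := iP (enum_val a) (enum_val b).
rewrite !enum_valK => Tab.
have s0 : \sum_c (T ^+ t) a c * (f a 0 - f c 0) = 0.
  have -> : \sum_c (T ^+ t) a c * (f a 0 - f c 0)
      = (T ^+ t *m one) a 0 * f a 0 - (T ^+ t *m f) a 0.
    rewrite !mxE mulr_suml -sumrB; apply: eq_bigr => c _.
    by rewrite !mxE mulr1 mulrBr.
  by rewrite transition_pow_one Ttf mxE mul1r subrr.
move/eqP: s0; rewrite psumr_eq0; last first.
  by move=> c _; rewrite mulr_ge0 ?transition_pow_ge0 // subr_ge0.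
move=> /allP /(_ b (mem_index_enum _)) /=; rewrite mulf_eq0 gt_eqF //=.
by rewrite subr_eq0 => /eqP.
Qed.

(** The matrix fixes [pirow] on the left, so a kernel vector has mean 0 under [pi]; it is then
    harmonic, hence constant, hence 0. *)
Lemma fundamental_unit : 1%:M - T + one *m pirow \in unitmx.
Proof.
set M := (X in X \in _); rewrite -unitmx_tr unitmxE unitfE.
apply/det0P => -[v v0 vM].
have Mv : M *m v^T = 0 by rewrite -[M]trmxK -trmx_mul vM trmx0.
have piM : pirow *m M = pirow.
  rewrite /M mulmxDr mulmxBr mulmx1 stationary_transition subrr add0r.
  by rewrite mulmxA stationary_one mul1mx.
have piv : pirow *m v^T = 0 by rewrite -piM -mulmxA Mv mulmx0.
have Tv : T *m v^T = v^T.
  move: Mv; rewrite /M mulmxDl -mulmxA piv mulmx0 addr0 mulmxBl mul1mx.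
  by move/eqP; rewrite subr_eq0 eq_sym => /eqP.
case/eqP: v0; apply/rowP => a.
have vc := harmonic_constant Tv.
have : (pirow *m v^T) 0 0 = v^T a 0 * (pirow *m one) 0 0.
  rewrite !mxE mulr_sumr; apply: eq_bigr => b _.
  by rewrite (vc b a) !mxE mulr1 mulrC.
by rewrite piv stationary_one !mxE eqxx mulr1.
Qed.

(** As [pirow *m Z = pirow], the inverse relation reduces to [Z - T *m Z = 1%:M - one *m pirow],
    read here in column [i]. *)
Lemma fundamental_poisson (j i : Sigma) :
  let Z := fundamental_mx P pi in
  Z (enum_rank j) (enum_rank i)
    - \sum_y P j y * Z (enum_rank y) (enum_rank i) = (j == i)%:R - pi i.
Proof.
set Z := fundamental_mx P pi => /=.
have MZ : (1%:M - T + one *m pirow) *m Z = 1%:M by rewrite mulmxV // fundamental_unit.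
have piZ : pirow *m Z = pirow.
  have piM : pirow *m (1%:M - T + one *m pirow) = pirow.
    rewrite mulmxDr mulmxBr mulmx1 stationary_transition subrr add0r.
    by rewrite mulmxA stationary_one mul1mx.
  by rewrite -[in LHS]piM -mulmxA MZ mulmx1.
have /(congr1 (fun M => fun_of_matrix M (enum_rank j) (enum_rank i))) :
    Z - T *m Z = 1%:M - one *m pirow.
  rewrite -MZ mulmxDl mulmxBl mul1mx -mulmxA piZ addrK //.
rewrite !mxE big_ord1 !mxE mul1r enum_rankK (inj_eq enum_rank_inj) => <-.
congr (_ - _); rewrite -sum_enum_val; apply: eq_bigr => a _.
by rewrite !mxE enum_rankK enum_valK.
Qed.

Lemma fundamental_le_Zmax (j i : Sigma) :
  `|fundamental_mx P pi (enum_rank j) (enum_rank i)| <= Zmax P pi i.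
Proof. exact: le_bigmax. Qed.

(** The function [w] vanishes at [i], so a killed step acts on it as a step of [P], and the Poisson
    equation gives its iterates in closed form ([wE]). At [i] the closed form is the left-hand side,
    while [w] is at most [2 * Zmax]. *)
Lemma truncation_bias (i : Sigma) (n : nat) :
  1 - pi i * truncated_mean P i n.+1 i
    <= 2 * Zmax P pi i * survival P i n.+1 i.
Proof.
pose Z k := fundamental_mx P pi (enum_rank k) (enum_rank i).
pose w j := Z i - Z j.
have wE m j : iter m.+1 (taboo P i) w j
    = w j - pi i * truncated_mean P i m.+1 j + (j == i)%:R.
  elim: m j => [|m IHm] j.
    have -> : iter 1 (taboo P i) w j = \sum_y P j y * w y.
      by rewrite /= /taboo [RHS](bigD1 i) //= /w subrr mulr0 add0r.
    under eq_bigr do rewrite mulrBr.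
    rewrite sumrB -mulr_suml sP.2 mul1r.
    have := fundamental_poisson j i; rewrite /= -!/(Z _).
    have -> : truncated_mean P i 1 j = 1 by rewrite /truncated_mean big_ord1.
    rewrite /w; lra.
  rewrite iterS.
  have -> : taboo P i (iter m.+1 (taboo P i) w) j =
      taboo P i w j - pi i * taboo P i (truncated_mean P i m.+1) j.
    rewrite /taboo mulr_sumr -sumrB; apply: eq_bigr => y /negPf yi.
    by rewrite IHm yi addr0 mulrBr [pi i * (P _ _ * _)]mulrCA.
  have -> : taboo P i w j = w j - pi i + (j == i)%:R.
    have := fundamental_poisson j i; rewrite /= -!/(Z _).
    have -> : taboo P i w j = \sum_y P j y * w y.
      by rewrite /taboo [RHS](bigD1 i) //= /w subrr mulr0 add0r.
    under [in X in _ -> X]eq_bigr do rewrite mulrBr.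
    rewrite sumrB -mulr_suml sP.2 mul1r /w; lra.
  rewrite taboo_truncated_mean; lra.
have := wE n i; rewrite eqxx [w i]subrr.
rewrite add0r addrC => <-.
apply: survival_le_iter => // j.
rewrite /w mulr_natl mulr2n; have := fundamental_le_Zmax i i.
have := fundamental_le_Zmax j i; rewrite -!/(Z _) !ler_norml; lra.
Qed.

End FundamentalMatrix.

(** * Decomposition of a probability along a discrete variable *)

Section Partition.
Context (R : realType) (d : measure_display) (Omega : measurableType d)
  (Pr : probability Omega R).

Lemma prob_finite_partition (T : finType) (f : Omega -> T) (A : set Omega) :
  (forall y, measurable (A `&` [set w | f w = y])) ->
  Pr A = (\sum_y Pr (A `&` [set w | f w = y]))%E.
Proof.
move=> mA.
have {1}-> : A = \bigcup_(y in [set: T]) (A `&` [set w | f w = y]).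
  by apply/seteqP; split => w /=; [move=> Aw; exists (f w) | case=> y _ []].
have tI : trivIset [set: T] (fun y => A `&` [set w | f w = y]).
  by move=> y z _ _ [w [[_ /= <-] [_ /= <-]]].
rewrite (measure_fin_bigcup _ finite_finset tI (fun y _ => mA y)).
rewrite (fsbigE (index_enum T)) ?index_enum_uniq //.
  by apply: eq_bigl => y; rewrite in_setT.
by move=> y _; rewrite mem_index_enum.
Qed.

Lemma prob_countable_partition (f : Omega -> nat) (A : set Omega) :
  (forall n, measurable (A `&` [set w | f w = n])) ->
  Pr A = (\sum_(n <oo) Pr (A `&` [set w | f w = n]))%E.
Proof.
move=> mA.
have {1}-> : A = \bigcup_n (A `&` [set w | f w = n]).
  by apply/seteqP; split => w /=; [move=> Aw; exists (f w) | case=> y _ []].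
rewrite measure_semi_bigcup //; last exact: bigcup_measurable.
by move=> y z _ _ [w [[_ /= <-] [_ /= <-]]].
Qed.

End Partition.

Arguments prob_finite_partition {R d Omega} Pr {T} f {A}.
Arguments prob_countable_partition {R d Omega} Pr f {A}.

(** * Events of a trajectory and of its stopping time *)

Section StateEvents.
Context (Sigma : finType) (d : measure_display) (Omega : measurableType d)
  (X : nat -> Omega -> Sigma) (i : Sigma).
Hypothesis mX : forall t x, measurable [set w | X t w = x].

Definition history (t : nat) (x : nat -> Sigma) : set Omega :=
  [set w | forall s, (s <= t)%N -> X s w = x s].

Definition avoids_between (t u : nat) : set Omega :=
  [set w | forall s, (t < s <= u)%N -> X s w != i].

Lemma measurable_state (t : nat) (B : set Sigma) :
  measurable [set w | B (X t w)].
Proof.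
have -> : [set w | B (X t w)] = \bigcup_(x in B) [set w | X t w = x].
  by apply/seteqP; split => w /=; [move=> Bw; exists (X t w) | case=> x Bx /= ->].
by apply: fin_bigcup_measurable => [|x _]; [exact: finite_finset | exact: mX].
Qed.

Lemma measurable_history (t : nat) (x : nat -> Sigma) :
  measurable (history t x).
Proof.
have -> : history t x = \bigcap_(s in [set s | (s <= t)%N]) [set w | X s w = x s].
  by apply/seteqP; split => w /= h s; exact: h.
by apply: bigcap_measurableType => s _; exact: mX.
Qed.

Lemma measurable_avoids_between (t u : nat) : measurable (avoids_between t u).
Proof.
have -> : avoids_between t u
    = \bigcap_(s in [set s | (t < s <= u)%N]) [set w | X s w != i].
  by apply/seteqP; split => w /= h s; exact: h.
apply: bigcap_measurableType => s _.
exact: (measurable_state s [set x | x != i]).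
Qed.

Lemma stop_time_le (theta : nat) (x : nat -> Sigma) :
  (0 < theta)%N -> (stop_time theta i x <= theta)%N.
Proof.
move=> t0; rewrite /stop_time -[X in (_ < X)%N](size_iota 1) -has_find.
by apply/hasP; exists theta; rewrite ?eqxx // mem_iota t0 add1n ltnSn.
Qed.

(** Below the cap [theta] only a visit to [i] stops the walk. The successor in [stop_time] matches
    positions, counted from 0, with times, counted from 1. *)
Lemma stop_time_gt (theta n : nat) (x : nat -> Sigma) : (n < theta)%N ->
  (n < stop_time theta i x)%N <-> (forall s, (0 < s <= n)%N -> x s != i).
Proof.
move=> nt; rewrite /stop_time ltnS; split.
  move=> nf s /andP[s0 sn].
  have /(before_find 0%N) : (s.-1 < find (fun t => (t == theta) || (x t == i))
      (iota 1 theta))%N by rewrite prednK // (leq_trans sn).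
  rewrite nth_iota ?add1n ?prednK //; last by rewrite (leq_trans sn) // ltnW.
  by move/negbT; rewrite negb_or => /andP[].
move=> h; rewrite leqNgt; apply/negP => fn.
have hs : has (fun t => (t == theta) || (x t == i)) (iota 1 theta).
  by rewrite has_find size_iota (leq_trans fn) // ltnW.
have := nth_find 0%N hs; rewrite nth_iota; last first.
  by rewrite -[X in (_ < X)%N](size_iota 1) -has_find.
rewrite add1n => /orP[/eqP e|]; last by apply/negP; apply: h.
by move: fn; rewrite e leqNgt nt.
Qed.

Lemma stop_time_gt_avoids (theta n : nat) :
  [set w | (n < stop_time theta.+1 i (X ^~ w))%N]
    = if (n < theta.+1)%N then avoids_between 0 n else set0.
Proof.
case: ifPn => nt; first by apply/seteqP; split => w /=; rewrite stop_time_gt.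
rewrite -subset0 => w /=; apply/negP; rewrite -leqNgt.
by rewrite -leqNgt in nt; rewrite (leq_trans (stop_time_le _ _)).
Qed.

Lemma stop_time_eq (theta v : nat) :
  [set w | stop_time theta i (X ^~ w) = v.+1]
    = [set w | (v < stop_time theta i (X ^~ w))%N]
      `\` [set w | (v.+1 < stop_time theta i (X ^~ w))%N].
Proof.
apply/seteqP; split => w /= => [->|]; first by rewrite ltnSn ltnn.
by move=> [v1 /negP]; rewrite -leqNgt => v2; apply/eqP; rewrite eqn_leq v2 v1.
Qed.

Lemma measurable_stop_time (theta v : nat) :
  measurable [set w | stop_time theta.+1 i (X ^~ w) = v].
Proof.
case: v => [|v].
  rewrite (_ : [set _ | _] = set0); first exact: measurable0.
  by rewrite -subset0 => w.
rewrite stop_time_eq !stop_time_gt_avoids; apply: measurableD.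
  by case: ifP => _; [exact: measurable_avoids_between | exact: measurable0].
by case: ifP => _; [exact: measurable_avoids_between | exact: measurable0].
Qed.

End StateEvents.

(** * The Markov property and avoidance probabilities *)

Section MarkovAvoid.
Context (R : realType) (Sigma : finType) (d : measure_display)
  (Omega : measurableType d) (Pr : probability Omega R)
  (X : nat -> Omega -> Sigma) (P : Sigma -> Sigma -> R) (j i : Sigma).
Hypotheses (sP : stochastic P) (mX : markov_chain Pr X P j).

Let mstate t x : measurable [set w | X t w = x].
Proof. by case: mX => m _ _; exact: m. Qed.

Local Notation history := (history X).
Local Notation avoids_between := (avoids_between X i).

Definition extend (t : nat) (x : nat -> Sigma) (y : Sigma) (s : nat) : Sigma :=
  if (s <= t)%N then x s else y.

Lemma historyS (t : nat) (x : nat -> Sigma) (y : Sigma) :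
  history t.+1 (extend t x y) = history t x `&` [set w | X t.+1 w = y].
Proof.
apply/seteqP; split => w /=.
  move=> h; split => [s st|]; last by rewrite (h t.+1) // /extend ltnn.
  by rewrite h /extend ?st // ltnW.
move=> [h Xy] s; rewrite leq_eqVlt => /predU1P[->|st].
  by rewrite /extend ltnn.
by rewrite /extend -ltnS st h.
Qed.

Lemma history_extend_prob (t : nat) (x : nat -> Sigma) (y : Sigma) :
  Pr (history t.+1 (extend t x y)) = (Pr (history t x) * (P (x t) y)%:E)%E.
Proof.
case: mX => _ _ /(_ t (extend t x y)) ->.
rewrite /extend leqnn ltnn; congr (Pr _ * _)%E.
by apply/seteqP; split => w /= h s st; have := h s st; rewrite st.
Qed.

(** Induction over all histories at once: split on the state at time [t.+1]; the value [i]
    contributes nothing, and any other value gives a longer history. *)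
Lemma history_avoids_prob (n t : nat) (x : nat -> Sigma) :
  Pr (history t x `&` avoids_between t (t + n))
    = (Pr (history t x) * (survival P i n (x t))%:E)%E.
Proof.
elim: n t x => [|n IHn] t x.
  rewrite mule1; congr (Pr _); apply/seteqP; split => w; first by case.
  move=> h; split => // s; rewrite addn0 => /andP[ts st].
  by move: (leq_trans ts st); rewrite ltnn.
have step y : history t x `&` avoids_between t (t + n.+1)
      `&` [set w | X t.+1 w = y] =
    if y == i then set0
    else history t.+1 (extend t x y) `&` avoids_between t.+1 (t.+1 + n).
  rewrite historyS addSnnS; case: eqP => [->|/eqP yi].
    rewrite -subset0 => w /= [[_ h] Xi].
    by have := h t.+1; rewrite Xi eqxx ltnSn addnS ltnS leq_addr => /(_ isT).
  apply/seteqP; split => w /= [[h1 h2] h3].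
    by split => // s /andP[ts su]; apply: h2; rewrite su ltnW.
  split => //; split => // s; rewrite leq_eqVlt => /andP[/predU1P[<- _|ts su]].
    by rewrite h2.
  by apply: h3; rewrite ts.
rewrite (prob_finite_partition Pr (X t.+1)); last first.
  move=> y; rewrite step; case: ifP => // _.
  exact: measurableI (measurable_history mstate _ _)
    (measurable_avoids_between i mstate _ _).
rewrite survivalS /taboo -sumEFin ge0_sume_distrr; last first.
  by move=> y _; rewrite lee_fin mulr_ge0 ?survival_ge0 ?sP.1.
rewrite (bigID (fun y => y == i)) /= big1 ?add0e; last first.
  by move=> y /eqP yi; rewrite step yi eqxx measure0.
apply: eq_bigr => y /negPf yi; rewrite step yi IHn history_extend_prob.
by rewrite /extend ltnn EFinM muleA.
Qed.

Lemma prob_avoids (n : nat) : Pr (avoids_between 0 n) = (survival P i n j)%:E.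
Proof.
have h1 : Pr (history 0 (fun=> j)) = 1%E.
  case: mX => _ <- _; congr (Pr _); apply/seteqP; split => w /= h.
    exact: (h 0%N).
  by case.
have mA := measurable_avoids_between i mstate 0 n.
have mh := measurable_history mstate 0 (fun=> j).
have := history_avoids_prob n 0 (fun=> j); rewrite h1 mul1e add0n => <-.
(* The start at [j] is only almost sure; paths starting elsewhere form a null set. *)
rewrite (measureDI Pr mA mh) setIC -[RHS]add0e; congr (_ + _)%E.
apply/eqP; rewrite eq_le measure_ge0 andbT.
have <- : Pr (~` history 0 (fun=> j)) = 0%E.
  by rewrite probability_setC // h1 subee.
apply: le_measure; rewrite ?inE; [exact: measurableD | exact: measurableC | by move=> w []].
Qed.

Lemma prob_stop_time_gt (theta n : nat) :
  Pr [set w | (n < stop_time theta.+1 i (X ^~ w))%N]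
    = (if (n < theta.+1)%N then survival P i n j else 0)%:E.
Proof.
by rewrite stop_time_gt_avoids; case: ifP => _; rewrite ?prob_avoids ?measure0.
Qed.

End MarkovAvoid.

Arguments prob_avoids {R Sigma d Omega Pr X P j} i sP mX n.
Arguments prob_stop_time_gt {R Sigma d Omega Pr X P j} i sP mX theta n.

(** * The hitting time as a random variable, and Markov's inequality *)

Section HittingTime.
Context (R : realType) (Sigma : finType) (d : measure_display)
  (Omega : measurableType d) (Pr : probability Omega R)
  (X : nat -> Omega -> Sigma) (P : Sigma -> Sigma -> R) (j i : Sigma).
Hypotheses (sP : stochastic P) (mX : markov_chain Pr X P j).

Let mstate t x : measurable [set w | X t w = x].
Proof. by case: mX => m _ _; exact: m. Qed.

Lemma hitting_time_gt (n : nat) :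
  [set w | (n%:R%:E < hitting_time R i (X ^~ w))%E] = avoids_between X i 0 n.
Proof.
apply/seteqP; split => w /= h.
  move=> s /andP[s1 sn]; apply/eqP => Xs.
  have : (hitting_time R i (X ^~ w) <= s%:R%:E)%E.
    by apply: ereal_inf_lbound; exists s.
  by apply/negP; rewrite -ltNge (le_lt_trans _ h) // lee_fin ler_nat.
apply: (@lt_le_trans _ _ n.+1%:R%:E); first by rewrite lte_fin ltr_nat.
apply/ereal_infP => _ [t [t1 /eqP Xt] <-]; rewrite lee_fin ler_nat ltnNge.
by apply/negP => tn; have := h t; rewrite t1 tn Xt => /(_ isT).
Qed.

Lemma measurable_hitting_time :
  measurable_fun setT ((fun w => hitting_time R i (X ^~ w)) : Omega -> \bar R).
Proof.
(* The infimum over a random set of times becomes the infimum of a sequence of measurable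
   functions. *)
pose g t w := if X t w == i then t%:R%:E else +oo%E : \bar R.
have -> : (fun w => hitting_time R i (X ^~ w)) = (fun w => einfs (g ^~ w) 1).
  apply/funext => w; apply/eqP; rewrite eq_le; apply/andP; split.
    apply/ereal_infP => _ [t /= t1 <-]; rewrite /g.
    case: eqP => [Xt|_]; last by rewrite leey.
    by apply: ereal_inf_lbound; exists t.
  apply/ereal_infP => _ [t [t1 Xt] <-].
  apply: ereal_inf_lbound; exists t => //=.
  by rewrite /g Xt eqxx.
apply: measurable_fun_einfs => t.
apply: measurable_fun_ifT; [|exact: measurable_cst|exact: measurable_cst].
apply: (@measurable_fun_bool _ _ _ _ true).
rewrite setTI; have := measurable_state mstate t [set x | x = i].
by congr measurable; apply/seteqP; split => w /= /eqP.
Qed.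

(** Markov's inequality, with integrality: exceeding [n] means being at least [n.+1]. *)
Lemma survival_markov (n : nat) :
  ((n.+1%:R * survival P i n j)%:E
     <= \int[Pr]_w hitting_time R i (X ^~ w))%E.
Proof.
have mA := measurable_avoids_between i mstate 0 n.
rewrite EFinM -(prob_avoids i sP mX n) -[avoids_between X i 0 n]setIT.
rewrite -(integral_indic _ measurableT mA) -ge0_integralZl //; last first.
  exact/measurable_EFinP.
apply: ge0_le_integral => //.
- by apply/measurable_EFinP/measurable_funM; [exact: measurable_cst | exact: measurable_indic].
- exact: measurable_hitting_time.
move=> w _; rewrite indicE; case: (boolP (w \in _)) => [|_]; last first.
  by rewrite mule0; apply/ereal_infP => _ [t _ <-].
rewrite inE -hitting_time_gt /= mule1 => nw.
apply/ereal_infP => y hy; have := lt_le_trans nw (ereal_inf_lbound hy).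
by case: hy => t _ <-; rewrite lte_fin lee_fin ltr_nat ler_nat.
Qed.

End HittingTime.

(** * Geometric tail in terms of the maximal hitting time *)

Section TailBound.
Context (R : realType) (Sigma : finType) (d : measure_display)
  (Omega : measurableType d) (PP : Sigma -> probability Omega R)
  (X : nat -> Omega -> Sigma) (P : Sigma -> Sigma -> R) (i : Sigma).
Hypotheses (sP : stochastic P) (mX : forall j, markov_chain (PP j) X P j).

(* If the maximal hitting time is infinite, then [fine] turns it into 0, the
   exponent n / 0 is 0, and the bound is trivial. *)
Lemma survival_hitting_time (n : nat) (x : Sigma) :
  survival P i n x
    <= 2 * 2 `^ (- (n%:R / (2 * fine (max_hitting_time PP X i)))).
Proof.
have triv : survival P i n x <= 2 * 2 `^ (- (n%:R / (2 * 0))).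
  rewrite mulr0 invr0 mulr0 oppr0 powRr0 mulr1.
  by rewrite (le_trans (survival_le1 _ sP n x)) // ler1n.
case Hh : (max_hitting_time PP X i) => [h||] //=.
have hle m y : m.+1%:R * survival P i m y <= h.
  rewrite -lee_fin -Hh; apply: le_trans (survival_markov i sP (mX y) m) _.
  exact: le_bigmax.
have h1 : 1 <= h by have := hle 0%N x; rewrite mul1r.
have h2 : 0 <= 2 * h by lra.
(* Block length: [m.+1] exceeds [2 * h], so from any state a block is survived with probability at
   most 1/2. *)
pose m := Num.truncn (2 * h).
have /andP[m1 m2] : m%:R <= 2 * h < m.+1%:R by rewrite /m truncn_itv.
have m0 : (0 < m)%N by rewrite /m truncn_gt0; lra.
have half y : survival P i m y <= 2^-1.
  have := hle m y; have := survival_ge0 i sP m y.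
  have : (0 : R) < m.+1%:R by rewrite ltr0n.
  nra.
pose q := (n %/ m)%N.
have sq : survival P i n x <= 2^-1 ^+ q.
  apply: le_trans (@survival_geometric _ _ _ _ sP _ m q x _ half).
    by apply: survival_anti => //; rewrite /q leq_divM.
  by rewrite invr_ge0 ler0n.
apply: le_trans sq _.
have nq : n%:R / (2 * h) <= q.+1%:R.
  rewrite ler_pdivrMr; last lra.
  have : n%:R <= q.+1%:R * m%:R :> R by rewrite -natrM ler_nat ltnW // ltn_ceil.
  have : (0 : R) < q.+1%:R by rewrite ltr0n.
  nra.
(* The leading factor 2 pays for rounding the number of blocks down. *)
have -> : 2^-1 ^+ q = 2 * 2 `^ (- q.+1%:R) :> R.
  by rewrite powRN powR_mulrn ?ler0n // exprS invfM mulrA divff ?pnatr_eq0 // mul1r exprVn.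
by rewrite ler_wpM2l // ler_powR ?lerN2 // ler1n.
Qed.

End TailBound.

(** * Exponential inequalities for the Chernoff bounds *)

Section ExponentialBounds.
Context (R : realType).
Implicit Types x a b : R.

(** The quotient [f] of the two sides has derivative [expR (- y) * y * (2 * a - 1 - a * y)], which
    has the sign of [y] between 0 and [x]; so [f] is at least [f 0 = 1] at [x]. *)
Lemma expR_le_quadratic a x : 1 / 2 <= a -> a * x <= 2 * a - 1 ->
  expR x <= 1 + x + a * x ^+ 2.
Proof.
move=> a2 ax.
pose f y : R := expR (- y) * (1 + y + a * y ^+ 2).
suff : f 0 <= f x.
  rewrite /f oppr0 expR0 mul1r addr0 expr0n mulr0 addr0 expRN => h.
  by rewrite -[leLHS]mulr1 -ler_pdivlMl ?expR_gt0.
have df (y : R) : is_derive y (1 : R) f (expR (- y) * y * (2 * a - 1 - a * y)).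
  have -> : f = (expR \o -%R) * (cst 1 + id + cst a * (id ^+ 2)) by [].
  have de : is_derive y 1 (expR \o -%R) (- expR (- y)).
    by apply: is_derive_eq; rewrite /GRing.scale /=; ring.
  apply: is_derive_eq; rewrite /GRing.scale /= /cst !fctE /GRing.scale /=; ring.
have cf : forall u v, {within `[u, v], continuous f}.
  move=> u v; apply: continuous_subspaceT => y.
  exact/differentiable_continuous/derivable1_diffP/ex_derive.
have key c : 0 <= c * x -> a * c <= 2 * a - 1 ->
    0 <= expR (- c) * c * (2 * a - 1 - a * c) * x.
  move=> cx ac; rewrite -!mulrA mulr_ge0 ?expR_ge0 // mulrCA mulrC mulr_ge0 //.
    by rewrite subr_ge0.
case: (leP 0 x) => x0.
  have [c cx fc] := MVT_segment x0 (fun y _ => df y) (cf 0 x).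
  move: cx; rewrite in_itv /= => /andP[c0 cx].
  rewrite -subr_ge0 fc subr0 key ?mulr_ge0 //.
  by apply: le_trans ax; rewrite ler_wpM2l //; lra.
have [c cx fc] := MVT_segment (ltW x0) (fun y _ => df y) (cf x 0).
move: cx; rewrite in_itv /= => /andP[xc c0].
rewrite -subr_ge0 -opprB fc sub0r mulrN opprK key //; first by rewrite mulr_le0 // ltW.
by apply: (@le_trans _ _ 0); [rewrite mulr_ge0_le0 //; lra | lra].
Qed.

(* Divide by expR (t * x) and apply 1 + y <= expR y to both terms. *)
Lemma expR_chord (t x : R) : 0 <= t <= 1 -> expR (t * x) <= 1 + t * (expR x - 1).
Proof.
move=> /andP[t0 t1].
have e1 : expR x = expR (t * x) * expR ((1 - t) * x).
  by rewrite -expRD; congr expR; ring.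
have e2 : expR (t * x) * expR (- (t * x)) = 1 by rewrite expRxMexpNx_1.
have l1 := expR_ge1Dx ((1 - t) * x); have l2 := expR_ge1Dx (- (t * x)).
have e0 := expR_gt0 (t * x).
have -> : 1 + t * (expR x - 1)
    = expR (t * x) * (t * expR ((1 - t) * x) + (1 - t) * expR (- (t * x))).
  by rewrite e1 [RHS]mulrDr [_ * ((1 - t) * _)]mulrCA e2; ring.
apply: ler_peMr; first exact: ltW.
have t1' : 0 <= 1 - t by lra.
apply: le_trans (lerD (ler_wpM2l t0 l1) (ler_wpM2l t1' l2)).
by rewrite le_eqVlt; apply/orP; left; apply/eqP; ring.
Qed.

(** At [2 / 3 * eps] the coefficient 3/4 is admissible for every [eps < 1], and the quadratic bound
    equals the right-hand side. *)
Lemma chernoff_exponent_upper (eps : R) : 0 < eps < 1 ->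
  expR (2 / 3 * eps) - 1 - 2 / 3 * eps * (1 + eps) <= - (eps ^+ 2 / 3).
Proof.
move=> /andP[e0 e1].
have : expR (2 / 3 * eps)
    <= 1 + 2 / 3 * eps + 3 / 4 * (2 / 3 * eps) ^+ 2.
  by apply: expR_le_quadratic; lra.
nra.
Qed.

(** The coefficient 1/2 gives the exponent [- 25 / 72 * eps ^+ 2], just below the required
    [- 24 / 72 * eps ^+ 2]. *)
Lemma chernoff_exponent_lower (eps : R) : 0 < eps < 1 ->
  expR (- (5 / 6 * eps)) - 1 + 5 / 6 * eps * (1 - 5 / 6 * eps)
    <= - (eps ^+ 2 / 3).
Proof.
move=> /andP[e0 e1].
have : expR (- (5 / 6 * eps))
    <= 1 + - (5 / 6 * eps) + 1 / 2 * (- (5 / 6 * eps)) ^+ 2.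
  by apply: expR_le_quadratic; lra.
nra.
Qed.

End ExponentialBounds.

(** * Measurability of discrete random variables *)

Section DiscreteMeasurability.
Context (d : measure_display) (Omega : measurableType d).

Definition discretely_measurable (T : Type) (f : Omega -> T) : Prop :=
  forall B : set T, measurable (f @^-1` B).

Lemma discretely_measurable_count (T : countType) (f : Omega -> T) :
  (forall a, measurable [set w | f w = a]) -> discretely_measurable f.
Proof.
move=> mf B.
have -> : f @^-1` B = \bigcup_n (if unpickle n is Some a then
    if a \in B then [set w | f w = a] else set0 else set0).
  apply/seteqP; split => w /=.
    by move=> Bf; exists (pickle (f w)) => //; rewrite pickleK mem_set.
  move=> [n _]; case: (unpickle n) => // a.
  by case: ifP => // /set_mem Ba /= ->.
apply: bigcupT_measurable => n; case: (unpickle n) => [a|]; last exact: measurable0.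
by case: ifP => _; [exact: mf | exact: measurable0].
Qed.

Lemma discretely_measurable_comp (T U : Type) (g : T -> U) (f : Omega -> T) :
  discretely_measurable f -> discretely_measurable (fun w => g (f w)).
Proof. by move=> mf B; exact: (mf (g @^-1` B)). Qed.

(** Handles quantities with a random index, such as a walk length summed over a random number of
    samples. *)
Lemma discretely_measurable_bind (T : countType) (U : Type) (f : Omega -> T)
    (g : T -> Omega -> U) :
  discretely_measurable f -> (forall a, discretely_measurable (g a)) ->
  discretely_measurable (fun w => g (f w) w).
Proof.
move=> mf mg B.
have -> : (fun w => g (f w) w) @^-1` B = \bigcup_n
    (if unpickle n is Some a then [set w | f w = a] `&` g a @^-1` B else set0).
  apply/seteqP; split => w /=.
    by move=> Bf; exists (pickle (f w)) => //; rewrite pickleK.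
  by move=> [n _]; case: (unpickle n) => // a [/= ->].
apply: bigcupT_measurable => n; case: (unpickle n) => [a|]; last exact: measurable0.
by apply: measurableI; [exact: (mf [set a]) | exact: mg].
Qed.

Lemma discretely_measurable_sum (Y : nat -> Omega -> nat) (N : nat) :
  (forall s, discretely_measurable (Y s)) ->
  discretely_measurable (fun w => \sum_(s < N) Y s w)%N.
Proof.
move=> mY; elim: N => [|N IHN].
  under [X in discretely_measurable X]eq_fun do rewrite big_ord0.
  move=> B; have [B0|B0] := pselect (B 0%N).
    by rewrite (_ : _ @^-1` _ = setT); [exact: measurableT | apply/seteqP; split].
  by rewrite (_ : _ @^-1` _ = set0); [exact: measurable0 | apply/seteqP; split].
under [X in discretely_measurable X]eq_fun do rewrite big_ord_recr.
apply: (@discretely_measurable_bind _ _ (fun w => \sum_(s < N) Y s w)%N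
  (fun a w => a + Y N w)%N) => // a.
exact: discretely_measurable_comp.
Qed.

End DiscreteMeasurability.

(** * Events independent of the walks not yet used *)

Section Independence.
Context (R : realType) (Sigma : finType) (I : eqType) (d : measure_display)
  (Omega : measurableType d) (Pr : probability Omega R)
  (W : I -> nat -> Omega -> Sigma).
Hypotheses (mW : forall j t x, measurable [set w | W j t w = x])
  (iW : independent_processes Pr W).

Lemma process_event_measurable (j : I) (A : set Omega) :
  process_sigma_algebra (W j) A -> measurable A.
Proof.
apply: smallest_sub; first exact: sigma_algebra_measurable.
by move=> _ [t [x ->]]; exact: mW.
Qed.

(** Stands in for conditioning: [A] is an event of the past, and [J] the set of walks it may depend
    on. *)
Definition indep_outside (J : set I) (A : set Omega) : Prop :=
  measurable A /\ forall (s : seq I) (B : I -> set Omega), uniq s ->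
    (forall j, j \in s -> ~ J j) ->
    (forall j, j \in s -> process_sigma_algebra (W j) (B j)) ->
    Pr (A `&` \bigcap_(j in [set` s]) B j) = (Pr A * \prod_(j <- s) Pr (B j))%E.

Lemma indep_outsideT (J : set I) : indep_outside J setT.
Proof.
split; first exact: measurableT.
by move=> s B us sJ sB; rewrite setTI probability_setT mul1e iW.
Qed.

Lemma indep_outside0 (J : set I) : indep_outside J set0.
Proof.
split; first exact: measurable0.
by move=> s B us sJ sB; rewrite set0I measure0 mul0e.
Qed.

Lemma indep_outside_sub (J K : set I) (A : set Omega) :
  J `<=` K -> indep_outside J A -> indep_outside K A.
Proof.
move=> JK [mA iA]; split => // s B us sK sB.
by apply: iA => // j js Jj; exact: sK js (JK _ Jj).
Qed.

Lemma indep_outside_prob (J : set I) (A B : set Omega) (j : I) :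
  indep_outside J A -> ~ J j -> process_sigma_algebra (W j) B ->
  Pr (A `&` B) = (Pr A * Pr B)%E.
Proof.
move=> [mA iA] Jj jB.
have := iA [:: j] (fun=> B); rewrite big_seq1 set_cons1 bigcap_set1.
by apply => // k; rewrite inE => /eqP ->.
Qed.

(** The event [B] joins the list of tested events, which is allowed because [j] is outside [J];
    afterwards [j] counts as used. *)
Lemma indep_outside_setI (J : set I) (A B : set Omega) (j : I) :
  indep_outside J A -> ~ J j -> process_sigma_algebra (W j) B ->
  indep_outside (J `|` [set j]) (A `&` B).
Proof.
move=> iJ Jj jB; have [mA iA] := iJ.
split; first exact: measurableI mA (process_event_measurable jB).
move=> s C us sJ sC.
have js : j \notin s by apply/negP => /sJ; apply; right.
rewrite (indep_outside_prob iJ Jj jB) -muleA.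
have := iA (j :: s) (fun k => if k == j then B else C k).
rewrite big_cons eqxx /= js us.
have -> : (\prod_(k <- s) Pr (if k == j then B else C k) = \prod_(k <- s) Pr (C k))%E.
  by apply: eq_big_seq => k ks; case: eqP => // kj; rewrite -kj ks in js.
move=> <- //.
- rewrite -setIA; congr (Pr (_ `&` _)); apply/seteqP; split => w /=.
    move=> [Bw Cw] k /=; case: eqP => // /eqP kj.
    by rewrite inE (negPf kj) => ks; exact: Cw.
  move=> h; split; first by have := h j; rewrite /= eqxx inE eqxx => /(_ isT).
  move=> k /= ks; have := h k; rewrite /= inE ks orbT.
  by case: eqP => [kj|_ /(_ isT)//]; rewrite -kj ks in js.
- move=> k; rewrite inE => /predU1P[-> //|ks Jk].
  by apply: (sJ k ks); left.
- move=> k; rewrite inE; case: eqP => [-> //|_ /= ks]; exact: sC.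
Qed.

(** Both sides of the product formula are countably additive in [A], so a random quantity may be
    fixed at each of its values. *)
Lemma indep_outside_partition (J : set I) (f : Omega -> nat) (A : set Omega) :
  (forall n, indep_outside J (A `&` [set w | f w = n])) -> indep_outside J A.
Proof.
move=> iA.
have mA n : measurable (A `&` [set w | f w = n]) by case: (iA n).
split.
  have -> : A = \bigcup_n (A `&` [set w | f w = n]).
    by apply/seteqP; split => w /=; [move=> Aw; exists (f w) | case=> y _ []].
  exact: bigcupT_measurable.
move=> s B us sJ sB.
have mB : measurable (\bigcap_(j in [set` s]) B j).
  apply: fin_bigcap_measurable => [|j js]; first exact: finite_seq.
  exact: process_event_measurable (sB j js).
have AB n : A `&` \bigcap_(j in [set` s]) B j `&` [set w | f w = n]
    = A `&` [set w | f w = n] `&` \bigcap_(j in [set` s]) B j by rewrite setIAC.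
rewrite (prob_countable_partition Pr f); last first.
  by move=> n; rewrite AB; exact: measurableI.
under eq_eseriesr => n _ do rewrite AB (iA n).2 //.
rewrite [in RHS](prob_countable_partition Pr f) //.
have pf : (\prod_(j <- s) Pr (B j))%E \is a fin_num.
  rewrite big_seq; apply: prode_fin_num => j js.
  apply: fin_num_measure; exact: process_event_measurable (sB _ js).
rewrite muleC -(fineK pf) -nneseriesZl //.
by apply: eq_eseriesr => n _; rewrite muleC.
Qed.

End Independence.

(** * Chernoff bound for independent sums, given the past *)

Section IndependentSums.
Context (R : realType) (Sigma : finType) (I : eqType) (d : measure_display)
  (Omega : measurableType d) (Pr : probability Omega R)
  (W : I -> nat -> Omega -> Sigma) (Y : I -> Omega -> nat) (js : nat -> I).
Hypotheses (mW : forall j t x, measurable [set w | W j t w = x])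
  (YW : forall j v, process_sigma_algebra (W j) [set w | Y j w = v])
  (js_inj : injective js).

Let mY j : discretely_measurable (Y j).
Proof.
apply: discretely_measurable_count => v.
exact: (process_event_measurable mW (YW v)).
Qed.

Lemma setI_sum_eq (F : set Omega) (N n v : nat) :
  F `&` [set w | (\sum_(s < N.+1) Y (js s) w)%N = n] `&` [set w | Y (js N) w = v]
  = if (v <= n)%N then F `&` [set w | Y (js N) w = v]
      `&` [set w | (\sum_(s < N) Y (js s) w)%N = n - v]%N else set0.
Proof.
case: ifPn => vn.
  apply/seteqP; split => w /= [[Fw]]; rewrite big_ord_recr /=.
    by move=> + Yv; rewrite Yv => Sn; split => //; rewrite -Sn addnK.
  by move=> -> ->; rewrite subnK.
rewrite -subset0 => w /= [[Fw]]; rewrite big_ord_recr /= => Sn Yv.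
by move: vn; rewrite -Sn -Yv leq_addl.
Qed.

Lemma indep_outside_sum (N n : nat) (J : set I) (F : set Omega) :
  indep_outside Pr W J F -> (forall s, (s < N)%N -> ~ J (js s)) ->
  indep_outside Pr W (J `|` [set js s | s in [set s | (s < N)%N]])
    (F `&` [set w | (\sum_(s < N) Y (js s) w)%N = n]).
Proof.
elim: N n J F => [|N IHN] n J F iF sJ.
  apply: (@indep_outside_sub _ _ _ _ _ _ _ J) => [k Jk|]; first by left.
  under eq_set do rewrite big_ord0.
  case: n => [|n]; last first.
    rewrite (_ : [set _ | _] = set0) ?setI0; first exact: indep_outside0.
    by apply/seteqP; split.
  by rewrite (_ : [set _ | _] = setT) ?setIT //; apply/seteqP; split.
apply: (indep_outside_partition mW (f := Y (js N))) => v.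
rewrite setI_sum_eq; case: ifP => vn; last exact: indep_outside0.
have iF' := indep_outside_setI mW iF (sJ N (ltnSn N)) (YW v).
apply: indep_outside_sub (IHN (n - v)%N _ _ iF' _).
  move=> k [[Jk|/= ->]|[s /= sN <-]].
  - by left.
  - by right; exists N => /=.
  - by right; exists s => //=; exact: ltnW.
move=> s sN [Js|/= /js_inj sN']; first exact: (sJ s (ltnW sN)).
by rewrite sN' ltnn in sN.
Qed.

Context (V : nat) (p : nat -> R) (lam M : R).
Hypotheses (YV : forall s w, (Y (js s) w <= V)%N)
  (Yp : forall s v, Pr [set w | Y (js s) w = v] = (p v)%:E)
  (pM : \sum_(v < V.+1) p v * expR (lam * v%:R) <= M).

(* Peeling off the last summand keeps the conditioning event independent of the
   remaining ones, so no joint law has to be written down. *)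
Lemma chernoff_conditioned (N : nat) (J : set I) (F : set Omega) (c : R) :
  indep_outside Pr W J F -> (forall s, (s < N)%N -> ~ J (js s)) ->
  (Pr (F `&` [set w | (c <= lam * (\sum_(s < N) Y (js s) w)%:R)%R])
     <= Pr F * (expR (- c) * M ^+ N)%:E)%E.
Proof.
have mS n b : measurable [set w | b <= lam * (\sum_(s < n) Y (js s) w)%:R].
  have := discretely_measurable_sum (Y := fun s => Y (js s)) n (fun s => mY (js s)).
  by move=> /(_ [set m | b <= lam * m%:R]).
elim: N J F c => [|N IHN] J F c iF sJ.
  under eq_set do rewrite big_ord0 mulr0.
  rewrite expr0 mulr1; case: (leP c 0) => c0.
    rewrite (_ : [set _ | _] = setT) ?setIT; last by apply/seteqP; split.
    rewrite -[leLHS]mule1 lee_wpmul2l // lee_fin.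
    by rewrite -expR0 ler_expR; lra.
  rewrite (_ : [set _ | _] = set0); last by apply/seteqP; split.
  by rewrite setI0 measure0 mule_ge0 // lee_fin expR_ge0.
have [mF _] := iF.
have fF : Pr F \is a fin_num by exact: fin_num_measure.
have mYv v : measurable [set w | Y (js N) w = v] by exact: (mY (js N) [set v]).
have step (v : 'I_V.+1) :
    F `&` [set w | c <= lam * (\sum_(s < N.+1) Y (js s) w)%:R]
      `&` [set w | inord (Y (js N) w) = v]
    = F `&` [set w | Y (js N) w = v]
      `&` [set w | c - lam * v%:R <= lam * (\sum_(s < N) Y (js s) w)%:R].
  have inordE w : (inord (Y (js N) w) = v) <-> (Y (js N) w = v :> nat).
    split => [<-|->]; first by rewrite inordK // ltnS YV.
    by apply: val_inj; rewrite /= inordK.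
  apply/seteqP; split => w /= [[Fw]]; rewrite inordE big_ord_recr /=.
    move=> + Yv; rewrite Yv natrD mulrDr => h; split => //; lra.
  move=> Yv h; rewrite Yv natrD mulrDr; split => //; split => //; lra.
rewrite (prob_finite_partition Pr (fun w => inord (Y (js N) w) : 'I_V.+1));
  last by move=> v; rewrite step; apply: measurableI => //; exact: measurableI.
(* Fixing the last summand at [v] lowers the threshold by [lam * v], which yields the factor
   [expR (lam * v)]; its average under [p] is at most [M]. *)
have bound (v : 'I_V.+1) :
    (Pr (F `&` [set w | (c <= lam * (\sum_(s < N.+1) Y (js s) w)%:R)%R]
      `&` [set w | inord (Y (js N) w) = v])
    <= Pr F * (expR (- c) * M ^+ N * (p v * expR (lam * v%:R)))%:E)%E.
  rewrite step; have iF' := indep_outside_setI mW iF (sJ N (ltnSn N)) (YW v).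
  apply: le_trans (IHN _ _ (c - lam * v%:R) iF' _) _.
    move=> s sN [Js|/= /js_inj sN']; first exact: (sJ s (ltnW sN)).
    by rewrite sN' ltnn in sN.
  rewrite (indep_outside_prob iF (sJ N (ltnSn N)) (YW v)) Yp.
  rewrite -muleA -EFinM opprB expRD.
  by rewrite le_eqVlt; apply/orP; left; apply/eqP; congr (_ * _%:E)%E; ring.
apply: le_trans (lee_sum _ (fun v _ => bound v)) _.
have M0 : 0 <= M.
  apply: le_trans pM; apply: sumr_ge0 => v _; rewrite mulr_ge0 ?expR_ge0 //.
  by rewrite -lee_fin -(Yp 0).
rewrite -(fineK fF) -(EFinM (fine _)).
under eq_bigr do rewrite -EFinM.
rewrite sumEFin lee_fin -mulr_sumr ler_wpM2l ?fine_ge0 //.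
by rewrite -mulr_sumr exprSr mulrA ler_wpM2l // mulr_ge0 ?expR_ge0 ?exprn_ge0.
Qed.

End IndependentSums.

(** * Law and moment generating function of the truncated return time *)

Section StopTimeLaw.
Context (R : realType) (Sigma : finType) (P : Sigma -> Sigma -> R) (i : Sigma).
Hypothesis sP : stochastic P.

Definition stop_tail (theta t : nat) : R :=
  if (t < theta)%N then survival P i t i else 0.

Definition stop_pmf (theta v : nat) : R :=
  if v is u.+1 then stop_tail theta u - stop_tail theta u.+1 else 0.

Lemma stop_pmf_ge0 (theta v : nat) : 0 <= stop_pmf theta v.
Proof.
case: v => //= v; rewrite subr_ge0 /stop_tail.
case: ltnP => h1; last by case: ifP => // _; exact: survival_ge0.
by rewrite ltnW //; exact: survival_anti.
Qed.

Lemma prob_stop_time_eq (d : measure_display) (Omega : measurableType d)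
    (Pr : probability Omega R) (X : nat -> Omega -> Sigma) (theta v : nat) :
  markov_chain Pr X P i ->
  Pr [set w | stop_time theta.+1 i (X ^~ w) = v] = (stop_pmf theta.+1 v)%:E.
Proof.
move=> mX; have mstate t x : measurable [set w | X t w = x] by case: mX => m _ _.
case: v => [|v].
  by rewrite (_ : [set _ | _] = set0) ?measure0 // -subset0 => w.
have mgt n : measurable [set w | (n < stop_time theta.+1 i (X ^~ w))%N].
  rewrite stop_time_gt_avoids; case: ifP => _; last exact: measurable0.
  exact: measurable_avoids_between.
rewrite stop_time_eq measureD //; last by rewrite ltey_eq fin_num_measure.
rewrite setIidr; last by move=> w /=; exact: ltnW.
have gt := prob_stop_time_gt i sP mX theta.
by rewrite /stop_pmf EFinB /stop_tail -!gt.
Qed.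

(** Summation by parts turns differences of tails back into tails; the tail vanishes at the cap. *)
Lemma sum_stop_pmf_affine (theta : nat) (a b : R) :
  \sum_(v < theta.+2) stop_pmf theta.+1 v * (a + v%:R * b)
    = a + truncated_mean P i theta.+1 i * b.
Proof.
rewrite big_ord_recl /= mul0r add0r.
have abel n : \sum_(u < n) stop_pmf theta.+1 (lift ord0 u) * (a + (lift ord0 u)%:R * b)
   = a * (stop_tail theta.+1 0 - stop_tail theta.+1 n)
     + (\sum_(u < n) stop_tail theta.+1 u - n%:R * stop_tail theta.+1 n) * b.
  elim: n => [|n IHn]; first by rewrite !big_ord0; ring.
  by rewrite !big_ord_recr /= IHn /bump /= add1n -[n.+1]addn1 natrD; ring.
rewrite abel /stop_tail ltnn /=.
under eq_bigr do rewrite ltn_ord.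
by rewrite /truncated_mean; ring.
Qed.

(** Up to the cap the exponential lies below its chord, which is affine in the length, so only the
    mean enters; then [1 + y <= expR y]. *)
Lemma stop_time_mgf (theta : nat) (lam : R) :
  \sum_(v < theta.+2) stop_pmf theta.+1 v * expR (lam * v%:R)
    <= expR (truncated_mean P i theta.+1 i / theta.+1%:R
             * (expR (lam * theta.+1%:R) - 1)).
Proof.
have t0 : (0 : R) < theta.+1%:R by rewrite ltr0n.
apply: le_trans (expR_ge1Dx _).
rewrite -mulrA -sum_stop_pmf_affine; apply: ler_sum => v _.
rewrite ler_wpM2l ?stop_pmf_ge0 //.
have -> : lam * v%:R = v%:R / theta.+1%:R * (lam * theta.+1%:R).
  by field; rewrite gt_eqF.
rewrite mulrA expR_chord // divr_ge0 ?ler0n //=.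
by rewrite ler_pdivrMr // mul1r ler_nat -ltnS.
Qed.

End StopTimeLaw.

(** * Deterministic analysis of a successful run *)

Section Run.
Context (R : realType) (Sigma : finType) (P : Sigma -> Sigma -> R) (i : Sigma)
  (eps alpha : R).
Hypotheses (sP : stochastic P) (eps01 : 0 < eps < 1) (alpha01 : 0 < alpha < 1).

Definition level_mean (k : nat) : R := truncated_mean P i (threshold k) i.

(** Its negative exponentiates to [alpha / (4 * 2 ^+ k)], the failure probability allotted to each
    tail of iteration [k]. *)
Definition log_factor (k : nat) : R := ln (4 * 2 ^+ k / alpha).

Definition large_sample (k N : nat) : Prop :=
  log_factor k <= N%:R * level_mean k / 2 ^+ k * (eps ^+ 2 / 3).

(* The lower deviation 5/6 eps instead of eps keeps the estimate within a
   constant factor of its mean uniformly in eps < 1, as needed to bound the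
   number of steps; the Chernoff lower tail is strong enough to afford it. *)
Definition concentrated (k N S : nat) : Prop :=
  (1 - 5 / 6 * eps) * (N%:R * level_mean k) <= S%:R
    <= (1 + eps) * (N%:R * level_mean k).

Lemma nat_ceil_ge (r : R) : 0 <= r -> r <= (nat_ceil r)%:R.
Proof.
move=> r0; rewrite /nat_ceil natr_absz ger0_norm; last by rewrite ceil_ge0; lra.
by case/andP: (ceil_itv r).
Qed.

Lemma nat_ceil_le (r : R) : 0 <= r -> (nat_ceil r)%:R <= r + 1.
Proof.
move=> r0; rewrite /nat_ceil natr_absz ger0_norm; last by rewrite ceil_ge0; lra.
by have := ceil_itv r; rewrite intrB => /andP[]; lra.
Qed.

Lemma threshold_natr (k : nat) : (threshold k)%:R = 2 ^+ k :> R.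
Proof. by rewrite /threshold natrX. Qed.

Lemma level_mean_ge1 (k : nat) : 1 <= level_mean k.
Proof. by apply: truncated_mean_ge1 => //; rewrite expn_gt0. Qed.

Lemma level_mean_mono (k : nat) : level_mean k <= level_mean k.+1.
Proof. by apply: truncated_mean_mono => //; rewrite leq_exp2l. Qed.

Lemma level_mean_double (k : nat) : level_mean k.+1 <= 2 * level_mean k.
Proof.
rewrite /level_mean /threshold expnS mul2n -addnn.
exact: truncated_mean_double.
Qed.

Lemma log_factor_mono (k l : nat) : (k <= l)%N -> log_factor k <= log_factor l.
Proof.
case/andP: alpha01 => a0 a1 kl; rewrite /log_factor ler_ln ?posrE; last 2 first.
- by rewrite divr_gt0 // mulr_gt0 // exprn_gt0.
- by rewrite divr_gt0 // mulr_gt0 // exprn_gt0.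
by rewrite ler_pM2r ?invr_gt0 // ler_pM2l // ler_eXn2l // ltr1n.
Qed.

Lemma log_factor_ge1 (k : nat) : 1 <= log_factor k.
Proof.
apply: (le_trans _ (log_factor_mono (leq0n k))).
case/andP: alpha01 => a0 a1.
rewrite /log_factor expr0 mulr1 -[leLHS](expRK 1) ler_ln ?posrE ?expR_gt0 ?divr_gt0 //.
have : expR (1 : R) <= 1 + 1 + 1 * 1 ^+ 2 by apply: expR_le_quadratic; lra.
rewrite ler_pdivlMr //; nra.
Qed.

Context (x : nat -> nat -> nat -> Sigma).

Local Notation ss := (sample_size i eps alpha x).
Local Notation That := (That i eps alpha x).

Definition walk_length (k N : nat) : nat :=
  (\sum_(s < N) stop_time (threshold k) i (x k s))%N.

(** The update rule as a function of two integers, so that fixing both determines the next sample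
    size. *)
Definition next_sample_size (k N S : nat) : nat :=
  nat_ceil (3 * (1 + eps) * (threshold k.+1)%:R
    * ln (4 * (threshold k.+1)%:R / alpha) / (N%:R^-1 * S%:R * eps ^+ 2)).

Lemma average_timeE (k N : nat) :
  average_time R i x k N = N%:R^-1 * (walk_length k N)%:R.
Proof. by rewrite /average_time /walk_length natr_sum. Qed.

Lemma sample_size1 :
  ss 1 = nat_ceil (6 * (1 + eps) * ln (8 / alpha) / eps ^+ 2).
Proof. by []. Qed.

Lemma sample_sizeS (k : nat) :
  ss k.+2 = next_sample_size k.+1 (ss k.+1) (walk_length k.+1 (ss k.+1)).
Proof. by rewrite /next_sample_size -average_timeE. Qed.

Lemma walk_length_le (k N : nat) : (walk_length k N <= N * threshold k)%N.
Proof.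
rewrite /walk_length -[N in leqRHS]card_ord -sum_nat_const; apply: leq_sum => s _.
by apply: stop_time_le; rewrite expn_gt0.
Qed.

Lemma iteration_steps (k : nat) : (ss k)%:R * That k = (walk_length k (ss k))%:R.
Proof.
rewrite /Defs.That average_timeE; case: (posnP (ss k)) => [->|s0].
  by rewrite mul0r /walk_length big_ord0.
by rewrite mulrA divff ?mul1r // pnatr_eq0 -lt0n.
Qed.

Lemma total_stepsE (k : nat) : total_steps i eps alpha x k
  = (\sum_(l < k) walk_length l.+1 (ss l.+1))%:R.
Proof.
rewrite /total_steps big_add1 big_mkord natr_sum.
by apply: eq_bigr => l _; exact: iteration_steps.
Qed.

Lemma large_sample_gt0 (k N : nat) : large_sample k N -> (0 < N)%N.
Proof.
case: N => // ; rewrite /large_sample !mul0r => h.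
have := log_factor_ge1 k; lra.
Qed.

Hypothesis run_ok : forall k, (0 < k)%N ->
  large_sample k (ss k) -> concentrated k (ss k) (walk_length k (ss k)).

(** The constant 6 is 3 times the first threshold 2, and the mean is at least 1. *)
Lemma large_sample1 : large_sample 1 (ss 1).
Proof.
case/andP: eps01 => e0 e1; rewrite /large_sample sample_size1.
have l1 := log_factor_ge1 1; have m1 := level_mean_ge1 1.
have l8 : ln (8 / alpha) = log_factor 1.
  by rewrite /log_factor expr1; congr (ln (_ / _)); rewrite -natrM.
rewrite l8 expr1; set r := (X in nat_ceil X).
have e2 : 0 < eps ^+ 2 by rewrite exprn_gt0.
have rE : r * (eps ^+ 2 / 6) = (1 + eps) * log_factor 1.
  by rewrite /r; field; rewrite gt_eqF.
have r0 : 0 <= r.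
    by apply: divr_ge0; [rewrite !mulr_ge0 //; lra | exact: ltW].
have := nat_ceil_ge r0; set N := (nat_ceil r)%:R => rN.
have : r * (eps ^+ 2 / 6) <= N * level_mean 1 * (eps ^+ 2 / 6).
  by rewrite ler_wpM2r //; [lra | nra].
rewrite rE => h; apply: (@le_trans _ _ ((1 + eps) * log_factor 1)); first nra.
by apply: le_trans h _; rewrite le_eqVlt; apply/orP; left; apply/eqP; field.
Qed.

Lemma That_bounds (k : nat) : (0 < k)%N -> large_sample k (ss k) ->
  (1 - 5 / 6 * eps) * level_mean k <= That k <= (1 + eps) * level_mean k.
Proof.
move=> k0 lk; have /andP[c1 c2] := run_ok k0 lk.
have N0 : (0 : R) < (ss k)%:R by rewrite ltr0n; exact: large_sample_gt0 lk.
rewrite /Defs.That average_timeE ler_pdivlMl // ler_pdivrMl //.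
by rewrite mulrCA c1 mulrCA c2.
Qed.

(** Success of a level gives an estimate at most [1 + eps] times its mean, hence times the next
    mean. The factor [1 + eps] in the sample size cancels this, which makes the next sample large
    and [run_ok] applicable again. *)
Lemma large_sample_all (k : nat) : large_sample k.+1 (ss k.+1).
Proof.
case/andP: eps01 => e0 e1; elim: k => [|k IHk]; first exact: large_sample1.
have /andP[T1 T2] := That_bounds (ltn0Sn k) IHk.
have l1 := log_factor_ge1 k.+2; have m1 := level_mean_ge1 k.+1.
have mm := level_mean_mono k.+1.
have T0 : 0 < That k.+1 by apply: lt_le_trans T1; rewrite mulr_gt0; lra.
rewrite /large_sample sample_sizeS /next_sample_size -average_timeE -/(That k.+1).
rewrite threshold_natr -/(log_factor k.+2); set r := (X in nat_ceil X).
have e2 : 0 < eps ^+ 2 by rewrite exprn_gt0.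
have t0 : 0 < 2 ^+ k.+2 :> R by rewrite exprn_gt0.
set t := 2 ^+ k.+2 in r t0 *.
have rE : r * (eps ^+ 2 / 3 / t) * That k.+1 = (1 + eps) * log_factor k.+2.
  by rewrite /r; field; rewrite !gt_eqF.
have r0 : 0 <= r.
  apply: divr_ge0; apply: mulr_ge0; [|lra|exact: ltW|exact: ltW].
  by apply: mulr_ge0; [lra | exact: ltW].
have := nat_ceil_ge r0; set N := (nat_ceil r)%:R => rN.
have q0 : 0 < eps ^+ 2 / 3 / t by rewrite !divr_gt0.
have -> : N * level_mean k.+2 / t * (eps ^+ 2 / 3)
    = N * (eps ^+ 2 / 3 / t) * level_mean k.+2.
  by field; rewrite gt_eqF.
set q := eps ^+ 2 / 3 / t in q0 rE *.
apply: (@le_trans _ _ (r * q * level_mean k.+2)); last first.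
  by rewrite ler_wpM2r ?ler_wpM2r // ?(ltW q0) //; lra.
have rq0 : 0 <= r * q by rewrite mulr_ge0 // ltW.
have h : r * q * That k.+1 <= r * q * ((1 + eps) * level_mean k.+2).
  by rewrite ler_wpM2l // (le_trans T2) // ler_wpM2l //; lra.
rewrite rE in h; rewrite -(ler_pM2l (_ : 0 < 1 + eps)); last lra.
by rewrite (le_trans h) // mulrCA.
Qed.

Lemma That_gt0 (k : nat) : 0 < That k.+1.
Proof.
have /andP[T1 _] := That_bounds (ltn0Sn k) (large_sample_all k).
case/andP: eps01 => e0 e1; have := level_mean_ge1 k.+1 => m1.
by apply: lt_le_trans T1; rewrite mulr_gt0; lra.
Qed.

Lemma iteration_steps_le (k n : nat) : (k < n)%N ->
  (walk_length k.+1 (ss k.+1))%:R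
    <= 145 * 2 ^+ k.+1 * (log_factor n / eps ^+ 2).
Proof.
case/andP: eps01 => e0 e1 kn.
have e2 : 0 < eps ^+ 2 by rewrite exprn_gt0.
have e21 : eps ^+ 2 <= 1 by rewrite expr_le1 // ltW.
have t0 : 0 < 2 ^+ k.+1 :> R by rewrite exprn_gt0.
have ln1 := log_factor_ge1 n.
have lkn := log_factor_mono kn; have l1 := log_factor_ge1 k.+1.
pose L := log_factor n / eps ^+ 2.
have L1 : 1 <= L by rewrite /L ler_pdivlMr //; lra.
rewrite -/L; case: k kn t0 lkn l1 => [|k] kn t0 lkn l1.
  rewrite -/L; have := walk_length_le 1 (ss 1); rewrite -(ler_nat R) natrM threshold_natr.
  move/le_trans; apply; rewrite sample_size1.
  have -> : ln (8 / alpha) = log_factor 1.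
    by rewrite /log_factor expr1; congr (ln (_ / _)); rewrite -natrM.
  set r := (X in nat_ceil X).
  have r0 : 0 <= r.
    by apply: divr_ge0; [rewrite !mulr_ge0 //; lra | exact: ltW].
  have rL : r <= 12 * L.
    by rewrite /r /L mulrA ler_pM2r ?invr_gt0 //; nra.
  have := nat_ceil_le r0; rewrite expr1; lra.
have /andP[T1 T2] := That_bounds (ltn0Sn k.+1) (large_sample_all k.+1).
have /andP[T1' T2'] := That_bounds (ltn0Sn k) (large_sample_all k).
have T0 := That_gt0 k; have T0' := That_gt0 k.+1.
have m1 := level_mean_ge1 k.+1; have md := level_mean_double k.+1.
(* The means at most double, [1 + eps] is below 2 and [1 - 5 / 6 * eps] above 1/6: the ratio is at
   most 2 * 2 * 6. *)
have T24 : That k.+2 <= 24 * That k.+1 by nra.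
have Tt : That k.+2 <= 2 ^+ k.+2.
  rewrite /Defs.That average_timeE.
  have N0 : (0 : R) < (ss k.+2)%:R.
    by rewrite ltr0n; exact: large_sample_gt0 (large_sample_all _).
  rewrite ler_pdivrMl // -threshold_natr -natrM ler_nat; exact: walk_length_le.
rewrite -iteration_steps sample_sizeS /next_sample_size -average_timeE -/(That k.+1).
rewrite threshold_natr -/(log_factor k.+2); set r := (X in nat_ceil X).
have r0 : 0 <= r.
  apply: divr_ge0; apply: mulr_ge0; [|lra|exact: ltW|exact: ltW].
  by apply: mulr_ge0; [lra | exact: ltW].
have rT : r * That k.+1 <= 6 * 2 ^+ k.+2 * L.
  have -> : r * That k.+1 = 3 * (1 + eps) * 2 ^+ k.+2 * (log_factor k.+2 / eps ^+ 2).
    by rewrite /r; field; rewrite !gt_eqF.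
  rewrite [leLHS](_ : _ = (3 * (1 + eps)) * (2 ^+ k.+2 * (log_factor k.+2 / eps ^+ 2)));
    last by ring.
  rewrite -[leRHS]mulrA; apply: ler_pM; [lra | | lra | ].
    by apply: mulr_ge0; [exact: ltW | apply: divr_ge0; [lra | exact: ltW]].
  by rewrite ler_pM2l // /L ler_pM2r ?invr_gt0.
have Nr := nat_ceil_le r0.
(* The constant 145 is 24 * 6 from [r], plus 1 from rounding up, since [That k.+2] is at most its
   threshold. *)
apply: (@le_trans _ _ ((r + 1) * That k.+2)).
  by rewrite ler_wpM2r // ltW.
have : r * That k.+2 <= r * (24 * That k.+1) by rewrite ler_wpM2l.
have : 2 ^+ k.+2 * 1 <= 2 ^+ k.+2 * L by rewrite ler_wpM2l // ltW.
lra.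
Qed.

Lemma total_steps_le (k : nat) : total_steps i eps alpha x k
  <= 290 * 2 ^+ k * (log_factor k / eps ^+ 2).
Proof.
rewrite total_stepsE natr_sum.
have L0 : 0 <= log_factor k / eps ^+ 2.
  by rewrite divr_ge0 ?sqr_ge0 //; have := log_factor_ge1 k; lra.
set L := log_factor k / eps ^+ 2 in L0 *.
have step (l : 'I_k) : (walk_length l.+1 (ss l.+1))%:R <= 145 * L * 2 ^+ l.+1.
  by rewrite mulrAC; exact: iteration_steps_le.
apply: le_trans (ler_sum _ (fun l _ => step l)) _.
rewrite -mulr_sumr.
have -> : \sum_(l < k) 2 ^+ l.+1 = 2 * 2 ^+ k - 2 :> R.
  elim: (k) => [|n IHn]; first by rewrite big_ord0 expr0; ring.
  by rewrite big_ord_recr /= IHn [2 ^+ n.+1]exprS; ring.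
have : 0 <= 2 ^+ k :> R by rewrite exprn_ge0.
nra.
Qed.

Lemma softO_ge_id (C y : R) : 0 <= C -> C * Num.max 1 y <= softO C 1 y.
Proof.
move=> C0; rewrite /softO ler_wpM2l // expr1 ler_peMr ?le_max ?ler01 //.
by rewrite lerDl ln_ge0 // le_max lexx.
Qed.

Lemma total_steps_softO (k : nat) : total_steps i eps alpha x k
  <= softO 10 1 (ln (1 / alpha)) * softO 10 1 (2 ^+ k) * softO 10 1 (1 / eps ^+ 2).
Proof.
case/andP: alpha01 => a0 a1; case/andP: eps01 => e0 e1.
have e2 : 0 < eps ^+ 2 by rewrite exprn_gt0.
apply: le_trans (total_steps_le k) _.
have t1 : 1 <= 2 ^+ k :> R by rewrite exprn_ege1 // ler1n.
set La := Num.max 1 (ln (1 / alpha)).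
have La1 : 1 <= La by rewrite /La le_max lexx.
have La2 : ln (1 / alpha) <= La by rewrite /La le_max lexx orbT.
have ln2 : 0 <= ln (2 : R) <= 1.
  rewrite ln_ge0 ?ler1n //=.
  have : (2 : R) <= expR 1 by have := expR_ge1Dx (1 : R); lra.
  by rewrite -ler_ln ?posrE ?expR_gt0 // expRK.
case/andP: ln2 => ln20 ln21.
set A := 1 + ln (2 ^+ k) : R.
have lnk : ln (2 ^+ k) = ln 2 *+ k :> R by rewrite lnXn.
have A1 : 1 <= A by rewrite /A lerDl lnk mulrn_wge0.
(* A sum of logarithms is bounded by a product because [A] and [La] are at least 1; [A] becomes the
   logarithmic factor of [softO] at [2 ^+ k]. *)
have logA : log_factor k <= 3 * (A * La).
  have -> : log_factor k = 2 * ln 2 + ln (2 ^+ k) + ln (1 / alpha).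
    rewrite /log_factor lnM ?posrE ?mulr_gt0 ?invr_gt0 ?exprn_gt0 //.
    rewrite lnM ?posrE ?exprn_gt0 // mul1r.
    have -> : (4 : R) = 2 ^+ 2 by rewrite expr2 -natrM.
    by rewrite lnXn // [2 * _]mulrC mulr_natr.
  have : A * 1 <= A * La by rewrite ler_wpM2l //; lra.
  have : 1 * La <= A * La by rewrite ler_wpM2r //; lra.
  rewrite /A; lra.
have sk : softO 10 1 (2 ^+ k) = 10 * (2 ^+ k * A).
  by rewrite /softO (max_idPr t1) expr1.
have sa : 10 * La <= softO 10 1 (ln (1 / alpha)) by apply: softO_ge_id; lra.
have se : 10 * (1 / eps ^+ 2) <= softO 10 1 (1 / eps ^+ 2).
  apply: le_trans (softO_ge_id _ _); last lra.
  by rewrite ler_wpM2l // le_max lexx orbT.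
have i0 : 0 <= 1 / eps ^+ 2 by rewrite divr_ge0 ?ler01 ?ltW.
(* The constant 10 in each factor suffices: 290 * 3 = 870 is below 1000. *)
apply: (@le_trans _ _ (10 * La * (10 * (2 ^+ k * A)) * (10 * (1 / eps ^+ 2)))).
  apply: (@le_trans _ _ (290 * 2 ^+ k * (3 * (A * La) / eps ^+ 2))).
    by rewrite ler_wpM2l ?mulr_ge0 // ?ler_wpM2r ?invr_ge0 // ?(ltW e2) //; lra.
  rewrite [leLHS](_ : _ = 870 * (La * (2 ^+ k * A) * (1 / eps ^+ 2))); last by ring.
  rewrite [leRHS](_ : _ = 1000 * (La * (2 ^+ k * A) * (1 / eps ^+ 2))); last by ring.
  apply: ler_wpM2r; last lra.
  apply: mulr_ge0 => //; apply: mulr_ge0; first lra.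
  by apply: mulr_ge0; lra.
have sk0 : 0 <= 10 * (2 ^+ k * A) by apply: mulr_ge0; [lra | apply: mulr_ge0; lra].
rewrite sk; apply: ler_pM => //; [|apply: mulr_ge0; lra|].
  by apply: mulr_ge0 => //; lra.
by apply: ler_wpM2r.
Qed.

End Run.

(** * Failure probability of the simulation *)

Section Simulation.
Context (R : realType) (Sigma : finType) (P : Sigma -> Sigma -> R) (i : Sigma)
  (eps alpha : R) (d : measure_display) (Omega : measurableType d)
  (Pr : probability Omega R) (W : nat * nat -> nat -> Omega -> Sigma).
Hypotheses (sP : stochastic P) (eps01 : 0 < eps < 1) (alpha01 : 0 < alpha < 1)
  (mW : forall ks, markov_chain Pr (W ks) P i)
  (iW : independent_processes Pr W).

Definition walk_time (ks : nat * nat) (w : Omega) : nat :=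
  stop_time (threshold ks.1) i (W ks ^~ w).

Definition trajectories (w : Omega) (k s t : nat) : Sigma := W (k, s) t w.

Let ss k w := sample_size i eps alpha (trajectories w) k.
Let steps k N w := walk_length i (trajectories w) k N.

Local Arguments sample_size : simpl never.

Let mstate ks t x : measurable [set w | W ks t w = x].
Proof. by case: (mW ks) => m _ _; exact: m. Qed.

Lemma threshold_predK (k : nat) : (threshold k).-1.+1 = threshold k.
Proof. by rewrite prednK // expn_gt0. Qed.

Lemma walk_time_event (ks : nat * nat) (v : nat) :
  process_sigma_algebra (W ks) [set w | walk_time ks w = v].
Proof.
rewrite /walk_time -threshold_predK.
(* Measurability of the stopping time is reused with the sigma-algebra generated by this walk
   alone. *)
pose G := [set A | exists t x, A = [set w | W ks t w = x]].
apply: (@measurable_stop_time _ _ (g_sigma_algebraType G) (W ks) i).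
by move=> t x; apply: sub_sigma_algebra; exists t, x.
Qed.

Let mwalk_time ks : discretely_measurable (walk_time ks).
Proof.
apply: discretely_measurable_count => v.
exact: (process_event_measurable mstate (walk_time_event v)).
Qed.

Let msteps k N : discretely_measurable (steps k N).
Proof. exact: (discretely_measurable_sum (Y := fun s => walk_time (k, s))). Qed.

(** Once the previous sample size and walk length are fixed, the event is decided; what remains is
    an event of earlier walks, by induction. *)
Lemma sample_size_indep (k n : nat) :
  indep_outside Pr W [set ks | (ks.1 < k)%N] [set w | ss k w = n].
Proof.
have const (J : set (nat * nat)) m n' :
    indep_outside Pr W J [set w : Omega | m = n' :> nat].
  have [->|mn] := eqVneq m n'.
    rewrite (_ : [set _ | _] = setT); first exact: indep_outsideT.
    by apply/seteqP; split.
  rewrite (_ : [set _ | _] = set0); first exact: indep_outside0.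
  by apply/seteqP; split => // w /= mn'; rewrite mn' eqxx in mn.
elim: k n => [|[|k] IHk] n; [exact: const | exact: const |].
apply: (indep_outside_partition mstate (f := ss k.+1)) => N.
apply: (indep_outside_partition mstate (f := steps k.+1 N)) => S.
rewrite (_ : _ `&` _ = if next_sample_size eps alpha k.+1 N S == n
    then [set w | ss k.+1 w = N] `&` [set w | steps k.+1 N w = S] else set0).
  case: ifP => _; last exact: indep_outside0.
  have inj : injective (pair k.+1 : nat -> nat * nat) by move=> s s' [].
  have := IHk N; set J := [set ks | _] => iN.
  have out s : (s < N)%N -> ~ J (k.+1, s) by move=> _; rewrite /J /= ltnn.
  have := indep_outside_sum mstate walk_time_event inj S iN out.
  apply: indep_outside_sub => -[l s] /= [/ltnW //|[s' _ [<- _]]]; exact: ltnSn.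
apply/seteqP; split => w /=.
  move=> [[h ssN] stS]; move: h; rewrite /ss sample_sizeS -/(ss k.+1 w) ssN.
  by rewrite -/(steps k.+1 N w) stS => ->; rewrite eqxx.
case: eqP => // e [ssN stS]; split => //; split => //.
by rewrite /ss sample_sizeS -/(ss k.+1 w) ssN -/(steps k.+1 N w) stS.
Qed.

Let mss k : discretely_measurable (ss k).
Proof.
by apply: discretely_measurable_count => n; case: (sample_size_indep k n).
Qed.

Lemma measurable_run_event (k : nat) (Q : nat -> nat -> Prop) :
  measurable [set w | Q (ss k w) (steps k (ss k w) w)].
Proof.
have := @discretely_measurable_bind _ _ _ _ (ss k) (fun N w => Q N (steps k N w)).
move=> /(_ (mss k) _ id); apply => N.
exact: discretely_measurable_comp.
Qed.

Lemma walk_time_le (k s : nat) (w : Omega) : (walk_time (k, s) w <= threshold k)%N.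
Proof. by apply: stop_time_le; rewrite expn_gt0. Qed.

Lemma walk_time_prob (k s v : nat) :
  Pr [set w | walk_time (k, s) w = v] = (stop_pmf P i (threshold k) v)%:E.
Proof. by rewrite /walk_time -threshold_predK (prob_stop_time_eq sP _ _ (mW _)). Qed.

Lemma walk_time_mgf (k : nat) (lam : R) :
  \sum_(v < (threshold k).+1) stop_pmf P i (threshold k) v * expR (lam * v%:R)
    <= expR (level_mean P i k / 2 ^+ k * (expR (lam * 2 ^+ k) - 1)).
Proof.
rewrite -threshold_natr /level_mean -(threshold_predK k).
exact: stop_time_mgf.
Qed.

(** Serves both tails: positive [h] gives the upper one, negative [h] the lower one. The Chernoff
    parameter is [h / 2 ^+ k] because lengths range up to [2 ^+ k]. *)
Lemma deviation_prob (k N : nat) (h q : R) :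
  large_sample P i eps alpha k N ->
  expR h - 1 - h * q <= - (eps ^+ 2 / 3) ->
  (Pr ([set w | ss k w = N]
      `&` [set w | (h * q * (N%:R * level_mean P i k) <= h * (steps k N w)%:R)%R])
    <= Pr [set w | ss k w = N] * (alpha / (4 * 2 ^+ k))%:E)%E.
Proof.
move=> lN hq; have [a0 a1] := andP alpha01.
have t0 : 0 < 2 ^+ k :> R by rewrite exprn_gt0.
have m1 := level_mean_ge1 i sP k.
set m := level_mean P i k in lN m1 *.
have inj : injective (pair k : nat -> nat * nat) by move=> s s' [].
have iN := sample_size_indep k N; set J := [set ks | _] in iN.
have out s : (s < N)%N -> ~ J (k, s) by move=> _; rewrite /J /= ltnn.
have := chernoff_conditioned mstate walk_time_event inj (walk_time_le k)
  (walk_time_prob k) (walk_time_mgf k (h / 2 ^+ k))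
  (h / 2 ^+ k * q * (N%:R * m)) iN out.
rewrite -/m.
have -> : [set w | h / 2 ^+ k * q * (N%:R * m)
     <= h / 2 ^+ k * (\sum_(s < N) walk_time (k, nat_of_ord s) w)%:R]
   = [set w | h * q * (N%:R * m) <= h * (steps k N w)%:R].
  have e1 y : h / 2 ^+ k * y = h * y / 2 ^+ k by rewrite mulrAC.
  have e2 w : (h / 2 ^+ k * q * (N%:R * m)
       <= h / 2 ^+ k * (\sum_(s < N) walk_time (k, nat_of_ord s) w)%:R)
      = (h * q * (N%:R * m) <= h * (steps k N w)%:R).
    by rewrite -[h / _ * q * _]mulrA !e1 mulrA ler_pM2r ?invr_gt0.
  by apply/seteqP; split => w /=; rewrite e2.
move/le_trans; apply.
apply: lee_wpmul2l => //; rewrite lee_fin mulfVK ?gt_eqF //.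
rewrite -expRM_natl -expRD.
have -> : - (h / 2 ^+ k * q * (N%:R * m)) + N%:R * (m / 2 ^+ k * (expR h - 1))
    = N%:R * m / 2 ^+ k * (expR h - 1 - h * q).
  by ring.
have -> : alpha / (4 * 2 ^+ k) = expR (- log_factor alpha k).
  rewrite expRN lnK ?invf_div // posrE divr_gt0 // mulr_gt0 //.
rewrite ler_expR.
apply: (@le_trans _ _ (N%:R * m / 2 ^+ k * - (eps ^+ 2 / 3))).
  by rewrite ler_wpM2l // divr_ge0 ?(ltW t0) // mulr_ge0 //; lra.
by rewrite mulrN lerN2.
Qed.

Definition failure (k : nat) : set Omega :=
  [set w | large_sample P i eps alpha k (ss k w)
           /\ ~ concentrated P i eps k (ss k w) (steps k (ss k w) w)].

Lemma measurable_failure (k : nat) : measurable (failure k).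
Proof.
exact: (measurable_run_event k (fun N S =>
  large_sample P i eps alpha k N /\ ~ concentrated P i eps k N S)).
Qed.

(** For each value of the sample size, failure is void or lies in the union of the two deviation
    events, which share the bound equally; then sum over the values. *)
Lemma failure_prob (k : nat) : (Pr (failure k) <= (alpha / 2 / 2 ^+ k)%:E)%E.
Proof.
have [a0 a1] := andP alpha01; have [e0 e1] := andP eps01.
have mssN N : measurable [set w | ss k w = N] by exact: (mss k [set N]).
have mFN N : measurable (failure k `&` [set w | ss k w = N]).
  by apply: measurableI => //; exact: measurable_failure.
rewrite (prob_countable_partition Pr (ss k)) //.
have b0 : 0 <= alpha / 2 / 2 ^+ k.
  by rewrite divr_ge0 ?exprn_ge0 //; lra.
have bound N : (Pr (failure k `&` [set w | ss k w = N])
    <= (alpha / 2 / 2 ^+ k)%:E * Pr [set w | ss k w = N])%E.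
  have [lN|lN] := pselect (large_sample P i eps alpha k N); last first.
    rewrite (_ : _ `&` _ = set0) ?measure0 ?mule_ge0 //.
    by rewrite -subset0 => w /= [[lw _] ssN]; rewrite ssN in lw.
  have mU h q : measurable ([set w | ss k w = N]
      `&` [set w | (h * q * (N%:R * level_mean P i k) <= h * (steps k N w)%:R)%R]).
    by apply: measurableI => //; exact: (msteps k N
      [set S | h * q * (N%:R * level_mean P i k) <= h * S%:R]).
  have up := deviation_prob lN (chernoff_exponent_upper eps01).
  have low_exp : expR (- (5 / 6 * eps)) - 1 - - (5 / 6 * eps) * (1 - 5 / 6 * eps)
      <= - (eps ^+ 2 / 3).
    by rewrite mulNr opprK; exact: chernoff_exponent_lower.
  have low := deviation_prob lN low_exp.
  rewrite (_ : alpha / 2 / 2 ^+ k = alpha / (4 * 2 ^+ k) + alpha / (4 * 2 ^+ k));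
    last by field; rewrite gt_eqF // exprn_gt0.
  rewrite muleC EFinD ge0_muleDr ?lee_fin; last 2 first.
  - by rewrite divr_ge0 // ?mulr_ge0 ?exprn_ge0 // ltW.
  - by rewrite divr_ge0 // ?mulr_ge0 ?exprn_ge0 // ltW.
  apply: le_trans (leeD up low); apply: le_trans (measureU2 _ _ _) => //.
  apply: le_measure; rewrite ?inE; [exact: mFN | exact: measurableU (mU _ _) (mU _ _) | ].
  move=> w /= [[_ nc] ssN]; rewrite ssN in nc.
  have h0 : 0 < 2 / 3 * eps by lra.
  have h1 : 0 < 5 / 6 * eps by lra.
  have [hi|hi] := leP ((1 + eps) * (N%:R * level_mean P i k)) (steps k N w)%:R.
    by left; split => //; rewrite -mulrA ler_pM2l.
  right; split => //; rewrite -mulrA !mulNr lerN2 ler_pM2l //.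
  by rewrite leNgt; apply/negP => lo; apply: nc; apply/andP; split; exact: ltW.
apply: le_trans (lee_nneseries _ (fun N _ => bound N)) _ => //.
rewrite nneseriesZl //.
have := prob_countable_partition Pr (ss k) (A := setT).
under eq_eseriesr do rewrite setTI.
rewrite probability_setT => <- //; first by rewrite mule1.
by move=> N; rewrite setTI.
Qed.

(** The union bound over iterations totals [alpha / 2], which leaves room for the strict
    inequality. *)
Lemma run_success_prob :
  ((1 - alpha)%:E < Pr (~` \bigcup_k failure k.+1))%E.
Proof.
have [a0 a1] := andP alpha01.
have mf k : measurable (failure k.+1) by exact: measurable_failure.
have mU : measurable (\bigcup_k failure k.+1) by exact: bigcupT_measurable.
have bound : (Pr (\bigcup_k failure k.+1) <= (alpha / 2)%:E)%E.
  apply: le_trans (generalized_Boole_inequality Pr mf mU) _.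
  apply: (@le_trans _ _ (\sum_(k <oo) (alpha / 2 / (2 ^ k.+1)%:R)%:E)%E).
    apply: lee_nneseries => // k _.
    by rewrite natrX; exact: failure_prob.
  by apply: epsilon_trick0; lra.
rewrite probability_setC //; move: bound.
have : Pr (\bigcup_k failure k.+1) \is a fin_num by exact: fin_num_measure.
by case: (Pr _) => // r _; rewrite lee_fin -EFinB lte_fin; lra.
Qed.

Lemma run_success_concentrated (w : Omega) :
  (~` \bigcup_k failure k.+1) w -> forall k, (0 < k)%N ->
  large_sample P i eps alpha k (ss k w) ->
  concentrated P i eps k (ss k w) (steps k (ss k w) w).
Proof.
move=> nf [//|k] _ lk; apply: contrapT => nc.
by apply: nf; exists k.
Qed.

Lemma measurable_run (Q : nat -> nat -> nat -> R -> Prop) :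
  measurable [set w | forall k, (1 <= k)%N ->
    Q k (ss k w) (steps k (ss k w) w) (total_steps i eps alpha (trajectories w) k)].
Proof.
have -> : [set w | forall k, (1 <= k)%N ->
    Q k (ss k w) (steps k (ss k w) w) (total_steps i eps alpha (trajectories w) k)]
  = \bigcap_(k in [set k | (1 <= k)%N]) [set w |
    Q k (ss k w) (steps k (ss k w) w) (total_steps i eps alpha (trajectories w) k)].
  by apply/seteqP; split => w /= h k; exact: h.
apply: bigcap_measurableType => k _.
pose total w := (\sum_(l < k) steps l.+1 (ss l.+1 w) w)%N.
have mtotal : discretely_measurable total.
  apply: (discretely_measurable_sum (Y := fun l w => steps l.+1 (ss l.+1 w) w)).
  by move=> l; exact: discretely_measurable_bind.
have -> : [set w |
    Q k (ss k w) (steps k (ss k w) w) (total_steps i eps alpha (trajectories w) k)]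
  = [set w | Q k (ss k w) (steps k (ss k w) w) (total w)%:R].
  by apply/seteqP; split => w /=; rewrite total_stepsE.
apply: (@discretely_measurable_bind _ _ _ _ (ss k)
  (fun N w => Q k N (steps k N w) (total w)%:R) (mss k) _ id) => N.
apply: (@discretely_measurable_bind _ _ _ _ (steps k N)
  (fun S w => Q k N S (total w)%:R) (msteps k N)) => S.
exact: (discretely_measurable_comp (fun T => Q k N S T%:R)).
Qed.

End Simulation.

(** * Bounds on the stationary probability *)

Section Estimate.
Context (R : realType) (Sigma : finType) (P : Sigma -> Sigma -> R)
  (pi : Sigma -> R) (i : Sigma) (eps alpha : R) (x : nat -> nat -> nat -> Sigma).
Hypotheses (sP : stochastic P) (iP : irreducible P) (spi : stationary P pi)
  (eps01 : 0 < eps < 1) (alpha01 : 0 < alpha < 1)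
  (run_ok : forall k, (0 < k)%N ->
    large_sample P i eps alpha k (sample_size i eps alpha x k) ->
    concentrated P i eps k (sample_size i eps alpha x k)
      (walk_length i x k (sample_size i eps alpha x k))).

Lemma Zmax_ge0 : 0 <= Zmax P pi i.
Proof. exact: le_trans (normr_ge0 _) (fundamental_le_Zmax P pi i i). Qed.

(** After multiplication by [That], both bounds compare [pi i * That] with [pi i * level_mean],
    which is at most 1 by stationarity and at least 1 minus the bias. *)
Lemma pihat_bounds (k : nat) :
  let ph := pihat i eps alpha x k.+1 in
  [/\ 0 < ph,
      (1 - eps - 2 * Zmax P pi i * survival P i (threshold k.+1) i) * ph <= pi i &
      pi i <= (1 + eps) * ph].
Proof.
rewrite /pihat /=.
have T0 := That_gt0 sP eps01 alpha01 run_ok k.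
have /andP[T1 T2] := That_bounds alpha01 run_ok (ltn0Sn k)
  (large_sample_all sP eps01 alpha01 run_ok k).
have [e0 e1] := andP eps01.
have m1 := level_mean_ge1 i sP k.+1.
have pm : pi i * level_mean P i k.+1 <= 1 by exact: stationary_truncated_mean_le1.
have pi0 : 0 <= pi i by case: spi.
have Z0 := Zmax_ge0; have s0 := survival_ge0 i sP (threshold k.+1) i.
have bias : 1 - pi i * level_mean P i k.+1
    <= 2 * Zmax P pi i * survival P i (threshold k.+1) i.
  rewrite /level_mean -(threshold_predK k.+1); exact: truncation_bias.
set Z := Zmax P pi i in Z0 bias *; set u := survival _ _ _ _ in s0 bias *.
set m := level_mean P i k.+1 in T1 T2 m1 pm bias *.
split; first by rewrite invr_gt0.
- rewrite ler_pdivrMr //; apply: (@le_trans _ _ (pi i * ((1 - eps) * m))).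
    have Zu : 0 <= Z * u by rewrite mulr_ge0.
    nra.
  rewrite ler_wpM2l //; apply: le_trans T1.
  by rewrite ler_wpM2r //; lra.
- rewrite ler_pdivlMr //; apply: (@le_trans _ _ (pi i * ((1 + eps) * m))).
    by rewrite ler_wpM2l.
  by rewrite mulrCA ler_piMr //; lra.
Qed.

End Estimate.

Theorem theorem1 (R : realType) :
  exists (C : R) (c : nat),
  forall (Sigma : finType) (P : Sigma -> Sigma -> R) (pi : Sigma -> R)
    (i : Sigma) (eps alpha : R)
    (* the chain X, with PP j its law started from j *)
    (d0 : measure_display) (Omega0 : measurableType d0)
    (PP : Sigma -> probability Omega0 R) (X : nat -> Omega0 -> Sigma)
    (* the simulated trajectories: W (k, s) is the s-th one of iteration k *)
    (d : measure_display) (Omega : measurableType d)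
    (Pr : probability Omega R) (W : nat * nat -> nat -> Omega -> Sigma),
  stochastic P -> irreducible P -> stationary P pi ->
  0 < eps < 1 -> 0 < alpha < 1 ->
  (forall j, markov_chain (PP j) X P j) ->
  (forall ks, markov_chain Pr (W ks) P i) ->
  independent_processes Pr W ->
  let walks (w : Omega) (k s t : nat) := W (k, s) t w in
  let H := fine (max_hitting_time PP X i) in
  let tail (k : nat) :=
    fine (PP i [set w | ((threshold k)%:R%:E < hitting_time R i (X ^~ w))%E]) in
  let good := [set w : Omega | forall k : nat, (1 <= k)%N ->
    let ph := pihat i eps alpha (walks w) k in
    [/\ (1 - eps - 4 * 2 `^ (- (2 ^+ k / (2 * H))) * Zmax P pi i) * ph
          <= (1 - eps - 2 * Zmax P pi i * tail k) * ph,
        (1 - eps - 2 * Zmax P pi i * tail k) * ph <= pi i,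
        pi i <= (1 + eps) * ph &
        total_steps i eps alpha (walks w) k
          <= softO C c (ln (1 / alpha)) * softO C c (2 ^+ k)
             * softO C c (1 / eps ^+ 2)]] in
  measurable good /\ ((1 - alpha)%:E < Pr good)%E.
Proof.
exists 10, 1%N => Sigma P pi i eps alpha d0 Omega0 PP X d Omega Pr W.
move=> sP iP spi eps01 alpha01 mX mW iW wlk H tail good.
have tailE k : tail k = survival P i (threshold k) i.
  by rewrite /tail hitting_time_gt (prob_avoids i sP (mX i)).
pose ok := ~` \bigcup_k failure P i eps alpha W k.+1.
have mgood : measurable good.
  (* The event depends on the walks only through the sample size, the walk length and the step total
     of each iteration. *)
  pose Q k N S total := let ph := (N%:R^-1 * S%:R)^-1 in
    [/\ (1 - eps - 4 * 2 `^ (- (2 ^+ k / (2 * H))) * Zmax P pi i) * ph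
          <= (1 - eps - 2 * Zmax P pi i * tail k) * ph,
        (1 - eps - 2 * Zmax P pi i * tail k) * ph <= pi i,
        pi i <= (1 + eps) * ph &
        total <= softO 10 1 (ln (1 / alpha)) * softO 10 1 (2 ^+ k)
             * softO 10 1 (1 / eps ^+ 2)] : Prop.
  have := measurable_run eps alpha mW iW Q.
  congr measurable; apply/seteqP; split => w /= h k k1; have := h k k1.
    by rewrite /Q -average_timeE.
  by rewrite /Q -average_timeE.
split => //.
have mok : measurable ok.
  by apply: measurableC; apply: bigcupT_measurable => k; exact: measurable_failure.
apply: lt_le_trans (run_success_prob sP eps01 alpha01 mW iW) _.
apply: le_measure; rewrite ?inE // => w okw [//|k] _.
have run_ok := run_success_concentrated okw.
have [ph0 low up] := pihat_bounds sP iP spi eps01 alpha01 run_ok k.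
split; [|by rewrite tailE|exact: up|exact: total_steps_softO run_ok k.+1].
(* Positivity of the estimate reduces the first inequality to the tail bound; the factor 4 is 2 from
   the bias times 2 from [survival_hitting_time]. *)
rewrite ler_pM2r //.
have := survival_hitting_time i sP mX (threshold k.+1) i.
rewrite -tailE threshold_natr -/H => tl.
have := Zmax_ge0 P pi i => Z0.
have : Zmax P pi i * tail k.+1
    <= Zmax P pi i * (2 * 2 `^ (- (2 ^+ k.+1 / (2 * H)))) by rewrite ler_wpM2l.
lra.
Qed.
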